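(* Let $D$ be an integral domain that is not a field, and let $L$ be a field containing $D$; suppose that $D$ is integrally closed in $L$. Then $\mathrm{Zar}(L|D)$ (respectively $\mathrm{Zar}_{\min}(L|D)$) is a Noetherian space if and only if the following three conditions hold: (1) $L$ is the quotient field of $D$; (2) $\mathrm{Spec}(D)$ is a Noetherian space (respectively, $\mathrm{Max}(D)$ is a Noetherian space); (3) for every $M\in\mathrm{Max}(D)$, the ring $D_M$ is a pseudo-valuation domain such that $\mathrm{Zar}(L_M|F_M)$ is a Noetherian space, where $F_M$ is the residue field of $D_M$ and $L_M$ is the residue field of the valuation overring of $D_M$ associated to $D_M$.
   Context: For an integral domain $D$ contained in a field $K$, $\mathrm{Zar}(K|D)$ is the set of all valuation domains that contain $D$ and have quotient field $K$, endowed with the Zariski topology: a subbasis of open sets is given by the sets $\{V\in\mathrm{Zar}(K|D)\mid x_1,\ldots,x_n\in V\}$, as $x_1,\ldots,x_n$ range in $K$. $\mathrm{Zar}_{\min}(K|D)$ is the subspace of the elements of $\mathrm{Zar}(K|D)$ that are minimal with respect to containment. $\mathrm{Spec}(D)$ carries the Zariski topology and $\mathrm{Max}(D)$ (the set of maximal ideals) the subspace topology. A topological space is Noetherian if its open sets satisfy the ascending chain condition (equivalently, every subset is compact, where compact does not include Hausdorff). An overring of a domain is a ring between it and its quotient field; a valuation overring is an overring that is a valuation domain. An integral domain $D$ with quotient field $K$ is a pseudo-valuation domain (PVD) if, for every prime ideal $P$ of $D$, whenever $xy\in P$ with $x,y\in K$, then $x\in P$ or $y\in P$; equivalently, $D$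 is local (has a unique maximal ideal) and its maximal ideal is also the maximal ideal of some valuation overring $V$ of $D$, which is called the valuation overring associated to $D$ (if $D$ is a valuation domain, $V=D$). *)

(* Defs.v *)
From HB Require Import structures.
From mathcomp Require Import all_boot all_order all_algebra.
From mathcomp Require Import generic_quotient ring_quotient.
From mathcomp Require Import all_classical topology.

Set Implicit Arguments.
Unset Strict Implicit.
Unset Printing Implicit Defensive.

Import GRing.Theory.

Local Open Scope classical_set_scope.
Local Open Scope ring_scope.
Local Open Scope quotient_scope.

Definition noetherian_space (T : topologicalType) : Prop :=
  forall U : nat -> set T,
    (forall n, open (U n)) -> (forall n, U n `<=` U n.+1) ->
    exists N, forall n, (N <= n)%N -> U n = U N.

Section Spectrum.
Variable R : comNzRingType.

(* [idealr_closed] includes properness (1 is not a member). *)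
Definition prime_ideal (P : set R) : Prop :=
  idealr_closed (mem P) /\ prime_idealr_closed (mem P).

Definition maximal_ideal (M : set R) : Prop :=
  idealr_closed (mem M) /\
  forall I : set R, idealr_closed (mem I) -> M `<=` I -> I = M.

Definition Spec : Type := {P : set R | `[< prime_ideal P >]}.

HB.instance Definition _ := Choice.on Spec.

Definition spec_set (P : Spec) : set R := val P.

Lemma spec_prime (P : Spec) : prime_ideal (spec_set P).
Proof. exact: (asboolW (valP P)). Qed.

Definition zero_locus (E : set R) : set Spec := [set P | E `<=` spec_set P].

Definition zariski_open (U : set Spec) : Prop :=
  exists E : set R, U = ~` zero_locus E.

Lemma zariski_openT : zariski_open setT.
Proof.
exists setT; apply/seteqP; split=> // P _ /= sub.
have [[_ /negP n1 _] _] := spec_prime P.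
by apply: n1; apply/mem_set/sub.
Qed.

Lemma zariski_openI : setI_closed zariski_open.
Proof.
move=> _ _ [E ->] [F ->].
exists [set z | exists x y, [/\ E x, F y & z = x * y]].
apply/seteqP; split=> P /=.
  move=> [nE nF] sub.
  have [x [Ex nPx]] : exists x, E x /\ ~ spec_set P x.
    by apply: contrapT => /forallNP h; apply: nE => x Ex;
       apply: contrapT => nPx; apply: (h x).
  have [y [Fy nPy]] : exists y, F y /\ ~ spec_set P y.
    by apply: contrapT => /forallNP h; apply: nF => y Fy;
       apply: contrapT => nPy; apply: (h y).
  have Pxy : spec_set P (x * y) by apply: sub; exists x, y.
  have [_ pP] := spec_prime P.
  by case/orP: (pP x y (mem_set Pxy)) => /set_mem.
have [[P0 P1 Pl] _] := spec_prime P.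
have PM a u : spec_set P u -> spec_set P (a * u).
  move=> Pu; apply: set_mem; rewrite -[a * u]addr0.
  by apply: Pl => //; apply/mem_set.
move=> n; split=> sub; apply: n => _ [x [y [Ex Fy ->]]].
  by rewrite mulrC; apply/PM/sub.
by apply/PM/sub.
Qed.

Lemma zariski_open_bigU (I : Type) (f : I -> set Spec) :
  (forall i, zariski_open (f i)) -> zariski_open (\bigcup_i f i).
Proof.
move=> /choice [E fE]; exists (\bigcup_i E i).
apply/seteqP; split=> P /=.
  by move=> [i _]; rewrite fE => n sub; apply: n => x Ex; apply: sub; exists i.
move=> n; apply: contrapT => h; apply: n => x [i _ Ex].
apply: contrapT => nPx; apply: h; exists i => //; rewrite fE => sub.
exact/nPx/sub.
Qed.

HB.instance Definition _ := isOpenTopological.Build Spec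
  zariski_openT zariski_openI zariski_open_bigU.

(* As a type, [set_type Max] carries the subspace topology. *)
Definition Max : set Spec := [set P | maximal_ideal (spec_set P)].

Definition max_set (M : Max) : set R := spec_set (val M).

Lemma max_maximal (M : Max) : maximal_ideal (max_set M).
Proof. exact: (set_mem (valP M)). Qed.

Definition max_pred (M : Max) : {pred R} := mem (max_set M).

Lemma max_pred_ideal (M : Max) : idealr_closed (max_pred M).
Proof. by case: (max_maximal M). Qed.

HB.instance Definition _ (M : Max) :=
  isIdealr.Build R (max_pred M) (max_pred_ideal M).

Definition residue_field (M : Max) : Type := {ideal_quot (max_pred M)}.

HB.instance Definition _ (M : Max) := GRing.ComNzRing.on (residue_field M).

Definition residue_map (M : Max) (a : R) : residue_field M :=
  \pi_({ideal_quot (max_pred M)}) a.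

Definition residue_inv (M : Max) (x : residue_field M) : residue_field M :=
  xget 0 [set y | y * x = 1].

Lemma residue_mulVf (M : Max) (x : residue_field M) :
  x != 0 -> residue_inv x * x = 1.
Proof.
move=> x0; suff [y yx] : exists y : residue_field M, y * x = 1.
  by rewrite /residue_inv; case: xgetP => // /(_ y).
pose p := residue_map M.
have p1 : p 1 = 1 by rewrite /p /residue_map rmorph1.
have pM a b : p (a * b) = p a * p b by rewrite /p /residue_map rmorphM.
have pD a b : p (a + b) = p a + p b by rewrite /p /residue_map rmorphD.
have p0P a : reflect (p a = 0) (a \in max_pred M).
  rewrite -[a]subr0 Quotient.idealrBE subr0.
  have -> : 0 = p 0 by rewrite /p /residue_map rmorph0.
  exact: eqP.
have [a xE] : exists a, x = p a by exists (repr x); rewrite /p /residue_map reprK.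
have nMa : a \notin max_pred M.
  by apply: contra_neqN x0 => /p0P; rewrite -xE.
have [[M0 M1 Ml] Mmax] := max_maximal M.
pose I : set R := [set m + r * a | m in max_set M & r in setT].
have IP m r : max_set M m -> I (m + r * a) by move=> Mm; exists m => //; exists r.
have MI : max_set M `<=` I.
  by move=> m Mm; have := IP m 0 Mm; rewrite mul0r addr0.
have [I1|nI1] := pselect (I 1); last first.
  have IE : I = max_set M.
    apply: Mmax => //.
    split; [exact/mem_set/MI/(set_mem M0) | by apply/negP => /set_mem |].
    move=> c _ _ /set_mem [m Mm [r _ <-]] /set_mem [n Mn [t _ <-]].
    apply/mem_set; have -> : c * (m + r * a) + (n + t * a) =
      (c * m + n) + (c * r + t) * a.
      by rewrite mulrDr mulrDl mulrA addrACA.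
    by apply: IP; apply: set_mem; apply: Ml; apply/mem_set.
  case/negP: nMa; apply/mem_set; rewrite -IE -[a]mul1r -[1 * a]add0r.
  exact/IP/(set_mem M0).
have [m Mm [r _ E]] := I1; exists (p r).
rewrite xE -pM -p1 -E pD; have /p0P -> : m \in max_pred M by exact/mem_set.
by rewrite add0r.
Qed.

Lemma residue_inv0 (M : Max) : residue_inv (0 : residue_field M) = 0.
Proof.
rewrite /residue_inv; case: xgetP => // y _ /=.
by rewrite mulr0 => /esym/eqP; rewrite oner_eq0.
Qed.

HB.instance Definition _ (M : Max) :=
  GRing.ComNzRing_isField.Build (residue_field M)
    (@residue_mulVf M) (residue_inv0 M).

End Spectrum.

Arguments Max R : clear implicits.

Definition is_field_ring (R : comNzRingType) : Prop :=
  forall x : R, x != 0 -> exists y : R, x * y = 1.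

Record subring (K : fieldType) : Type := Subring {
  subring_set : set K;
  subring_setP : subring_closed (mem subring_set)
}.

HB.instance Definition _ (K : fieldType) := gen_eqMixin (subring K).
HB.instance Definition _ (K : fieldType) := gen_choiceMixin (subring K).

Section SubringRing.
Variables (K : fieldType) (S : subring K).

Definition subring_pred : {pred K} := mem (subring_set S).

HB.instance Definition _ :=
  GRing.isSubringClosed.Build K subring_pred (subring_setP S).

Definition subring_sort : Type := {x : K | x \in subring_pred}.

HB.instance Definition _ := SubChoice.on subring_sort.
HB.instance Definition _ :=
  [SubChoice_isSubComNzRing of subring_sort by <:].

End SubringRing.

Coercion subring_sort : subring >-> Sortclass.

Section Subrings.
Variable K : fieldType.
Implicit Types (R V W : subring K).

Definition integrally_closed_in R : Prop :=
  forall z : K, integralOver (val : R -> K) z -> subring_set R z.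

Definition quotient_field R : set K :=
  [set x | exists a b : R, b != 0 /\ x = val a / val b].

Definition valuation_domain V : Prop :=
  forall x, quotient_field V x -> subring_set V x \/ subring_set V x^-1.

Definition localization_set R (P : Spec R) : set K :=
  [set x | exists a s : R, ~ spec_set P s /\ x = val a / val s].

Lemma localization_subring R (P : Spec R) :
  subring_closed (mem (localization_set P)).
Proof.
have [[P0 /negP P1 Pl] Pp] := spec_prime P.
have valn0 (s : R) : ~ spec_set P s -> val s != 0.
  move=> nPs; apply/negP => /eqP s0; apply: nPs.
  by have -> : s = 0 by [exact: val_inj]; exact: set_mem P0.
have mulnP (s t : R) : ~ spec_set P s -> ~ spec_set P t -> ~ spec_set P (s * t).
  by move=> nPs nPt /mem_set /Pp /orP [] /set_mem.
split.
- apply/mem_set; exists 1, 1; split; last by rewrite !rmorph1 divr1.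
  by move=> h; apply: P1; apply/mem_set.
- move=> _ _ /set_mem [a [s [nPs ->]]] /set_mem [b [t [nPt ->]]].
  apply/mem_set; exists (a * t - b * s), (s * t); split; first exact: mulnP.
  rewrite rmorphB !rmorphM /= -(mulNr (val b) (val t)^-1) addf_div ?valn0 //.
  by rewrite mulNr.
- move=> _ _ /set_mem [a [s [nPs ->]]] /set_mem [b [t [nPt ->]]].
  apply/mem_set; exists (a * b), (s * t); split; first exact: mulnP.
  by rewrite !rmorphM /= mulf_div.
Qed.

Definition localization R (P : Spec R) : subring K :=
  Subring (localization_subring P).

Definition pseudo_valuation_domain R : Prop :=
  forall (P : Spec R) (x y : K), quotient_field R x -> quotient_field R y ->
    (val @` spec_set P) (x * y) ->
    (val @` spec_set P) x \/ (val @` spec_set P) y.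

Definition valuation_overring R V : Prop :=
  [/\ subring_set R `<=` subring_set V,
      subring_set V `<=` quotient_field R & valuation_domain V].

(* Maximal ideals of [R] and [V] are compared as subsets of [K]. *)
Definition associated_valuation_overring R V (N : Max V) : Prop :=
  valuation_overring R V /\
  exists M : Max R, val @` max_set M = val @` max_set N.

(* Image of [R] in the residue field [V / N]; when [R] and [V] share the       *)
(* maximal ideal [N], this is the residue field of [R] embedded in [V / N].    *)
Definition residue_image R V (N : Max V) : set (residue_field N) :=
  [set residue_map N v | v in [set v : V | subring_set R (val v)]].

Definition zar_set (A : set K) : set (subring K) :=
  [set V | [/\ A `<=` subring_set V, valuation_domain V
             & quotient_field V = setT]].

Definition Zar (A : set K) : Type := {V : subring K | V \in zar_set A}.

HB.instance Definition _ (A : set K) := Choice.on (Zar A).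

(* [isSubBaseTopological] asks for a pointed index type. *)
HB.instance Definition _ := isPointed.Build (seq K) [::].

HB.instance Definition _ (A : set K) :=
  isSubBaseTopological.Build (Zar A) setT
    (fun s : seq K => [set V : Zar A | {in s, forall x, subring_set (val V) x}]).

Definition Zar_min (A : set K) : set (Zar A) :=
  [set V | forall W : Zar A, subring_set (val W) `<=` subring_set (val V) ->
                             subring_set (val W) = subring_set (val V)].

End Subrings.

Arguments residue_image {K} R {V} N.
Arguments Zar_min {K} A.

(* The valuation overring associated to a pseudo-valuation domain [R] is       *)
(* unique, so the existential quantifier over it is harmless.                  *)
Definition pvd_noetherian_residue (K : fieldType) (R : subring K) : Prop :=
  pseudo_valuation_domain R /\
  exists (V : subring K) (N : Max V),
    associated_valuation_overring R N /\
    noetherian_space (Zar (residue_image R N)).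

(* Main.v *)
Require Import Defs.
From HB Require Import structures.
From mathcomp Require Import all_boot all_order all_algebra.
From mathcomp Require Import generic_quotient ring_quotient.
From mathcomp Require Import all_classical topology ring.

Set Implicit Arguments.
Unset Strict Implicit.
Unset Printing Implicit Defensive.

Import GRing.Theory.

Local Open Scope classical_set_scope.
Local Open Scope ring_scope.

(** All spaces of valuation rings are subspaces of one space, that of the
    subrings of [L], where the set of rings containing a given finite set is
    open. For a valuation ring [V] above [D], write [m_V] for its maximal ideal;
    its centre is the prime [m_V] meets [D] in, and taking centres is
    continuous. Valuation rings are produced by Chevalley's theorem
    ([valring_extension]), and minimal ones exist below any given one; the
    centre of a minimal one is maximal.

    Necessity rests on one construction ([infinitely_many_slopes]). Suppose
    that for every [n] some valuation ring [W_n] above [D] has [y] in its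
    maximal ideal and [y ^ (2n+1) / x ^ 2] among its units, so that the value of
    [x] is [n + 1/2] times that of [y]. Then the open sets defined by [y] and
    [y ^ n / x] form a strictly ascending chain on the minimal valuation rings.
    It is used twice.

    - Let [P] be a prime of [D] and [x * y] in [P D_P]. If neither [x] nor [y]
      is in [D_P], then neither [u = y ^ (2n+1) / x ^ 2] nor [u^-1] is, and by
      Seidenberg's lemma ([root_outside_prime]) [u] is a unit in a valuation
      ring whose centre contains [P]. Hence [x] or [y] is in [D_P]
      ([mul_local_ideal]). With [x * y] a nonzero nonunit of [D] this gives that
      [L] is the quotient field of [D]; and it makes [D_P] a pseudo-valuation
      domain with maximal ideal [m = P D_P] and associated valuation ring
      [V = (m : m)].
    - Let [W' < W < V] be valuation rings above [D] where [V] has a maximal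
      centre. Some [x] in [m_W] and [y] in [m_W'] are then independent enough
      over [D] to admit the rings [W_n]. Hence every valuation ring strictly
      below [V] is minimal ([below_minimal]), and the space attached to the
      residue field of [V] embeds into the minimal valuation rings together with
      the point [V].

    The spaces [Spec D] and [Max D] are images of the spaces of all, resp. of
    minimal valuation rings under the centre map.

    For sufficiency let [Y] be [Spec D] or [Max D]. Each [P] in [Y] has a
    largest valuation ring [F P] centred on it: the one associated to [D_P] if
    [P] is maximal, and [D_P] itself otherwise. For [x] in [F P], all points of
    [Y] near [P] but perhaps [P] itself have [x] in their localization
    ([isolated]). So [P |-> F P] is continuous, and of an ascending chain [U n]
    of open sets the preimages in [Y] stabilize, say at [N]. Where [F P] is not
    in [U N] no ring centred on [P] is ever reached; and by compactness of the
    remaining part of [Y], [U N] contains all rings centred outside a finite set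
    of primes. The rings centred on one of these form a Noetherian space by
    hypothesis ([noetherian_of_centers]). *)

(** * Noetherian subsets of a topological space *)

Section NoetherianSubsets.
Implicit Types (S T : topologicalType).

Definition noetherian_on T (A : set T) : Prop :=
  forall U : nat -> set T,
    (forall n, open (U n)) -> (forall n, U n `<=` U n.+1) ->
    exists N, forall n, (N <= n)%N -> A `&` U n `<=` U N.

Lemma ascending_le T (U : nat -> set T) m n :
  (forall n, U n `<=` U n.+1) -> (m <= n)%N -> U m `<=` U n.
Proof.
move=> Uup /subnK <-; elim: (n - m)%N => [//|k IH] x /IH; exact: Uup.
Qed.

Lemma noetherian_spaceE T : noetherian_space T <-> noetherian_on [set: T].
Proof.
split=> noeT U oU Uup; have [N NP] := noeT U oU Uup; exists N => n Nn.
  by move=> x [_]; rewrite (NP n Nn).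
apply/seteqP; split; last exact: ascending_le.
by move=> x Ux; apply: (NP n Nn).
Qed.

(** The open sets of [S] and of [T] are matched through a relation [r], not a
    map, since the centre of a valuation ring and its preimage in a residue
    field are only specified by their membership. *)
Lemma noetherian_transfer S T (r : S -> T -> Prop) (B : set S) (A : set T) :
  (forall t, A t -> exists2 s, B s & r s t) ->
  (forall O : set T, open O -> exists2 O' : set S, open O' &
     forall s t, A t -> r s t -> (O' s <-> O t)) ->
  noetherian_on B -> noetherian_on A.
Proof.
move=> AB oTS noeB U oU Uup.
have /choice[O OP] : forall n, exists O' : set S, open O' /\
    forall s t, A t -> r s t -> (O' s <-> U n t).
  by move=> n; have [O' oO' OP] := oTS _ (oU n); exists O'.
(* The open sets matched with the [U n] need not ascend; their partial unions
   do. *)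
pose O1 n := \bigcup_(k in [set k | (k <= n)%N]) O k.
have O1P n s t : A t -> r s t -> (O1 n s <-> U n t).
  move=> At rst; split.
    by move=> [k /= kn /((OP k).2 _ _ At rst)]; exact: ascending_le.
  by move=> Ut; exists n => //=; apply/((OP n).2 _ _ At rst).
have [||N NP] := noeB O1.
- by move=> n; apply: bigcup_open => k _; exact: (OP k).1.
- by move=> n s [k /= kn Oks]; exists k => //=; exact: leqW.
exists N => n Nn t [At Unt]; have [s Bs rst] := AB t At.
by apply/(O1P N s t At rst)/(NP n Nn); split=> //; apply/(O1P n s t At rst).
Qed.

Lemma noetherian_onS T (A B : set T) :
  A `<=` B -> noetherian_on B -> noetherian_on A.
Proof.
move=> AB noeB U oU Uup; have [N NP] := noeB U oU Uup.
exists N => n Nn x [Ax Ux].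
by apply: (NP n Nn); split=> //; exact: AB.
Qed.

Lemma noetherian_onU T (A B : set T) :
  noetherian_on A -> noetherian_on B -> noetherian_on (A `|` B).
Proof.
move=> noeA noeB U oU Uup; have [M MP] := noeA U oU Uup.
have [N NP] := noeB U oU Uup; exists (maxn M N) => n; rewrite geq_max.
move=> /andP[Mn Nn] x [[Ax|Bx] Ux].
  by apply: (ascending_le Uup (leq_maxl M N)); exact: (MP n Mn).
by apply: (ascending_le Uup (leq_maxr M N)); exact: (NP n Nn).
Qed.

Lemma noetherian_on1 T (a : T) : noetherian_on [set a].
Proof.
move=> U oU Uup; have [[N UN]|nU] := pselect (exists N, U N a).
  by exists N => n _ x [->].
by exists 0%N => n _ x [-> Ux]; case: nU; exists n.
Qed.

Lemma noetherian_maximal T (A : set T) (F : set (set T)) :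
  noetherian_on A -> F !=set0 -> F `<=` open ->
  exists2 U, F U & forall U', F U' -> U `<=` U' -> A `&` U' `<=` U.
Proof.
move=> noeA [U0 FU0] oF; apply: contrapT => nmax.
have step (U : {U | F U}) : exists U' : {U | F U},
    sval U `<=` sval U' /\ ~ A `&` sval U' `<=` sval U.
  apply: contrapT => nU'; apply: nmax; exists (sval U); first exact: (svalP U).
  move=> U' FU' UU'; apply: contrapT => nsub.
  by apply: nU'; exists (exist _ U' FU').
have [next nextP] := choice step.
pose U n : {U | F U} := iter n next (exist _ U0 FU0).
have [|n|N NP] := noeA (fun n => sval (U n)).
- by move=> n; apply/oF/(svalP (U n)).
- exact: (nextP (U n)).1.
exact: (nextP (U N)).2 (NP N.+1 (leqnSn N)).
Qed.

Lemma noetherian_cover T (A : set T) (O : T -> set T) :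
  noetherian_on A -> (forall a, A a -> open (O a) /\ O a a) ->
  exists2 s : seq T, {in s, forall a, A a} &
    A `<=` [set x | exists2 a, a \in s & O a x].
Proof.
move=> noeA OP.
pose F : set (set T) := [set U | exists2 s : seq T, {in s, forall a, A a} &
  U = \bigcup_(a in [set` s]) O a].
have [||_ [s sA ->] smax] := noetherian_maximal noeA (F := F).
- by exists set0, [::] => //; rewrite set_nil bigcup_set0.
- by move=> _ [s sA ->]; apply: bigcup_open => a /= /sA /OP [].
exists s => // a Aa.
have [] := smax (\bigcup_(b in [set` a :: s]) O b) _ _ a.
- by exists (a :: s) => // b; rewrite inE => /predU1P[->|/sA].
- by move=> x [b /= bs Obx]; exists b => //=; rewrite inE bs orbT.
- by split=> //; exists a; [rewrite /= inE eqxx|exact: (OP a Aa).2].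
- by move=> b /= bs Oba; exists b.
Qed.

End NoetherianSubsets.

(** * The Zariski topology on the set of all subrings *)

Local Notation "x \inr V" := (subring_set V x) (at level 70, no associativity).

Section SubringSpace.
Variable K : fieldType.
Implicit Types (V W : subring K) (U : set (subring K)).

Definition contains (s : seq K) : set (subring K) :=
  [set V | {in s, forall x, x \inr V}].

Lemma contains_cat (s t : seq K) V :
  contains (s ++ t) V <-> contains s V /\ contains t V.
Proof.
split=> [h|[hs ht] x]; last by rewrite mem_cat => /orP[/hs|/ht].
by split=> x xs; apply: h; rewrite mem_cat xs ?orbT.
Qed.

Lemma contains_sub (s : seq K) V W :
  subring_set V `<=` subring_set W -> contains s V -> contains s W.
Proof. by move=> VW sV x /sV /VW. Qed.

(** Each [Zar A] is a subspace of this one, so that its subsets may be compared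
    for different base rings [A]. *)
Definition subring_open U : Prop :=
  forall V, U V -> exists2 s, contains s V & contains s `<=` U.

Lemma subring_openT : subring_open setT.
Proof. by move=> V _; exists [::]. Qed.

Lemma subring_openI : setI_closed subring_open.
Proof.
move=> U1 U2 o1 o2 V [/o1[s sV sU] /o2[t tV tU]]; exists (s ++ t).
  exact/contains_cat.
by move=> W /contains_cat[/sU U1W /tU U2W].
Qed.

Lemma subring_open_bigU (I : Type) (f : I -> set (subring K)) :
  (forall i, subring_open (f i)) -> subring_open (\bigcup_i f i).
Proof.
move=> of_ V [i _ /of_[s sV sU]]; exists s => // W /sU fW.
by exists i.
Qed.

HB.instance Definition _ := isOpenTopological.Build (subring K)
  subring_openT subring_openI subring_open_bigU.

Lemma subring_openE U : open U = subring_open U.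
Proof. by []. Qed.

Lemma open_contains (s : seq K) : open (contains s).
Proof. by move=> V sV; exists s. Qed.

Lemma open_sub U V W :
  open U -> U V -> subring_set V `<=` subring_set W -> U W.
Proof.
by move=> oU /oU[s sV sU] VW; apply/sU/(contains_sub VW).
Qed.

Lemma subring_ext V W : subring_set V = subring_set W -> V = W.
Proof.
case: V W => [V hV] [W hW] /= VW; subst W.
by congr Subring; exact: Prop_irrelevance.
Qed.

Lemma ZarP (A : set K) (V : Zar A) : zar_set A (val V).
Proof. exact: (set_mem (valP V)). Qed.

Lemma open_Zar (A : set K) (U : set (subring K)) :
  open U -> open [set V : Zar A | U (val V)].
Proof.
move=> oU; have /choice[s sP] : forall V : {V | U V}, exists s : seq K,
    contains s (sval V) /\ contains s `<=` U.
  by case=> V UV; have [s] := oU V UV; exists s.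
suff -> : [set V : Zar A | U (val V)] =
    \bigcup_i [set V : Zar A | contains (s i) (val V)].
  apply: bigcup_open => i _.
  exists [set [set V : Zar A | contains (s i) (val V)]]; last first.
    by rewrite bigcup_set1.
  by move=> _ ->; exact: finI_from1.
apply/seteqP; split=> V /=.
  by move=> UV; exists (exist _ _ UV) => //; exact: (sP (exist _ _ UV)).1.
by move=> [i _ /(sP i).2].
Qed.

Lemma Zar_openP (A : set K) (O : set (Zar A)) : open O ->
  exists2 U : set (subring K), open U & forall V : Zar A, U (val V) <-> O V.
Proof.
move=> oO.
pose U := [set V | exists2 s, contains s V &
  [set W : Zar A | contains s (val W)] `<=` O].
exists U; first by move=> V [s sV sO]; exists s => // W sW; exists s.
move=> V; split; first by move=> [s sV]; apply.
case: oO => F FfinI FO; rewrite -[X in X V -> _]FO => -[B FB].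
change (B V -> U (val V)) => BV; have [D _ DB] := FfinI _ FB.
exists (flatten (finmap.enum_fset D)).
  by move=> x /flattenP[s sD]; move: BV; rewrite -DB => /(_ s sD); apply.
move=> W sW; rewrite -FO; exists B => //; change (B W).
rewrite -DB => i iD x xi.
by apply: sW; apply/flattenP; exists i.
Qed.

Definition zar_min_set (A : set K) : set (subring K) :=
  [set V | zar_set A V /\ forall W, zar_set A W ->
     subring_set W `<=` subring_set V -> subring_set W = subring_set V].

Lemma noetherian_ZarE (A : set K) :
  noetherian_space (Zar A) <-> noetherian_on (zar_set A).
Proof.
rewrite noetherian_spaceE; split.
- apply: (noetherian_transfer (r := fun (V : Zar A) W => val V = W)).
    by move=> W AW; exists (exist _ W (mem_set AW)).
  move=> O oO; exists [set V : Zar A | O (val V)]; first exact: open_Zar.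
  by move=> V _ _ <-.
- apply: (noetherian_transfer (r := fun W (V : Zar A) => val V = W)).
    by move=> V _; exists (val V) => //; exact: ZarP.
  move=> O /Zar_openP[U oU UP]; exists U => //.
  by move=> _ V _ <-; exact: UP.
Qed.

Lemma Zar_minE (A : set K) (V : Zar A) : Zar_min A V <-> zar_min_set A (val V).
Proof.
split=> [minV|[_ minV] W]; last by apply: minV; exact: ZarP.
split; first exact: ZarP.
by move=> W AW; exact: (minV (exist _ W (mem_set AW))).
Qed.

Lemma noetherian_set_type (T : topologicalType) (A : set T) :
  noetherian_space (set_type A) <-> noetherian_on A.
Proof.
rewrite noetherian_spaceE; split.
- apply: (noetherian_transfer (r := fun (x : A) y => val x = y)).
    by move=> y Ay; exists (exist _ y (mem_set Ay)).
  move=> O oO; exists [set x : A | O (val x)]; first by exists O.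
  by move=> V _ _ <-.
- apply: (noetherian_transfer (r := fun y (x : A) => val x = y)).
    by move=> x _; exists (val x) => //; exact: (set_mem (valP x)).
  move=> O [U oU <-]; exists U => //.
  by move=> _ V _ <-.
Qed.

Lemma noetherian_Zar_minE (A : set K) :
  noetherian_space (set_type (Zar_min A)) <-> noetherian_on (zar_min_set A).
Proof.
rewrite noetherian_set_type; split.
- apply: (noetherian_transfer (r := fun (V : Zar A) W => val V = W)).
    move=> W minW; exists (exist _ W (mem_set minW.1)) => //.
    exact/Zar_minE.
  move=> O oO; exists [set V : Zar A | O (val V)]; first exact: open_Zar.
  by move=> V _ _ <-.
- apply: (noetherian_transfer (r := fun W (V : Zar A) => val V = W)).
    by move=> V minV; exists (val V) => //; exact/Zar_minE.
  move=> O /Zar_openP[U oU UP]; exists U => //.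
  by move=> _ V _ <-; exact: UP.
Qed.

End SubringSpace.

(** * Valuation rings and Chevalley's extension theorem *)

Section Subrings.
Variable K : fieldType.
Implicit Types (A B V W : subring K) (S I J : set K) (x y z : K).
Implicit Types (p q : {poly K}).

Lemma subring_closedI S :
  S 1 -> (forall x y, S x -> S y -> S (x - y)) ->
  (forall x y, S x -> S y -> S (x * y)) -> subring_closed (mem S).
Proof.
move=> S1 SB SM; split; first exact/mem_set.
  by move=> x y /set_mem Sx /set_mem Sy; apply/mem_set/SB.
by move=> x y /set_mem Sx /set_mem Sy; apply/mem_set/SM.
Qed.

Lemma inrP V x : x \inr V <-> x \in subring_pred V.
Proof. by split=> [/mem_set|/set_mem]. Qed.

Lemma inr_val V (v : V) : val v \inr V.
Proof. exact/inrP/(valP v). Qed.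

Lemma inr_sub V x : x \inr V -> exists v : V, val v = x.
Proof. by move=> /inrP xV; exists (exist _ x xV). Qed.

Lemma inr0 V : 0 \inr V. Proof. by apply/inrP; rewrite rpred0. Qed.
Lemma inr1 V : 1 \inr V. Proof. by apply/inrP; rewrite rpred1. Qed.
Lemma inrD V x y : x \inr V -> y \inr V -> x + y \inr V.
Proof. by move=> /inrP ? /inrP ?; apply/inrP; rewrite rpredD. Qed.
Lemma inrN V x : x \inr V -> - x \inr V.
Proof. by move=> /inrP ?; apply/inrP; rewrite rpredN. Qed.
Lemma inrB V x y : x \inr V -> y \inr V -> x - y \inr V.
Proof. by move=> /inrP ? /inrP ?; apply/inrP; rewrite rpredB. Qed.
Lemma inrM V x y : x \inr V -> y \inr V -> x * y \inr V.
Proof. by move=> /inrP ? /inrP ?; apply/inrP; rewrite rpredM. Qed.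
Lemma inrX V x n : x \inr V -> x ^+ n \inr V.
Proof. by move=> /inrP ?; apply/inrP; rewrite rpredX. Qed.

Definition proper_ideal_in B J : Prop :=
  [/\ J `<=` subring_set B, J 0, forall x y, J x -> J y -> J (x + y),
      forall b x, b \inr B -> J x -> J (b * x) & ~ J 1].

Definition poly_in S p : Prop := forall i, S p`_i.

(** The ring [B[x]] for [S] a ring [B]; the ideal [J B[x]] for [S] an
    ideal [J] of [B]. *)
Definition evals S x : set K := [set p.[x] | p in poly_in S].

Section Ideal.
Variables (B : subring K) (J : set K).
Hypotheses (J0 : J 0) (JD : forall x y, J x -> J y -> J (x + y)).
Hypothesis JM : forall b x, b \inr B -> J x -> J (b * x).

Lemma idealN x : J x -> J (- x).
Proof. by rewrite -mulN1r; apply/JM/inrN/inr1. Qed.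

Lemma ideal_sum (T : Type) (r : seq T) (P : pred T) (F : T -> K) :
  (forall i, P i -> J (F i)) -> J (\sum_(i <- r | P i) F i).
Proof. by move=> JF; apply: big_ind. Qed.

Lemma poly_inD p q : poly_in J p -> poly_in J q -> poly_in J (p + q).
Proof. by move=> Jp Jq i; rewrite coefD; apply: JD. Qed.

Lemma poly_inN p : poly_in J p -> poly_in J (- p).
Proof. by move=> Jp i; rewrite coefN; apply: idealN. Qed.

Lemma poly_inM p q : poly_in (subring_set B) p -> poly_in J q ->
  poly_in J (p * q).
Proof.
by move=> Bp Jq i; rewrite coefM; apply: ideal_sum => j _; exact: JM.
Qed.

Lemma poly_inC x : J x -> poly_in J x%:P.
Proof. by move=> Jx i; rewrite coefC; case: ifP. Qed.

Lemma poly_in_poly n (E : nat -> K) :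
  (forall i, (i < n)%N -> J (E i)) -> poly_in J (\poly_(i < n) E i).
Proof. by move=> JE i; rewrite coef_poly; case: ifP => // /JE. Qed.

Lemma evals_const x : J `<=` evals J x.
Proof. by move=> y Jy; exists y%:P; [exact: poly_inC|rewrite hornerC]. Qed.

End Ideal.

Lemma poly_inX B : poly_in (subring_set B) 'X.
Proof.
by move=> i; rewrite coefX; case: eqP => _; [exact: inr1|exact: inr0].
Qed.

Lemma poly_inXn B n : poly_in (subring_set B) 'X^n.
Proof.
by move=> i; rewrite coefXn; case: eqP => _; [exact: inr1|exact: inr0].
Qed.

Lemma adjoin_subproof B x : subring_closed (mem (evals (subring_set B) x)).
Proof.
apply: subring_closedI.
- by apply: evals_const; [exact: inr0|exact: inr1].
- move=> _ _ [p Bp <-] [q Bq <-].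
  exists (p - q); last by rewrite hornerD hornerN.
  apply: poly_inD => //; first exact: inrD.
  by apply: poly_inN Bq => // b y; exact: inrM.
- move=> _ _ [p Bp <-] [q Bq <-]; exists (p * q); last by rewrite hornerM.
  apply: poly_inM Bp Bq; [exact: inr0|exact: inrD|exact: inrM].
Qed.

Definition adjoin B x : subring K := Subring (adjoin_subproof B x).

Lemma adjoin_sub B x : subring_set B `<=` subring_set (adjoin B x).
Proof. exact/evals_const/inr0. Qed.

Lemma adjoin_gen B x : x \inr adjoin B x.
Proof. by exists 'X; [exact: poly_inX|rewrite hornerX]. Qed.

Lemma adjoin_ideal B J x : proper_ideal_in B J -> ~ evals J x 1 ->
  proper_ideal_in (adjoin B x) (evals J x).
Proof.
move=> [JB J0 JD JM J1] nJ1; split=> //.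
- by move=> _ [p Jp <-]; exists p => // i; exact/JB/Jp.
- exact: evals_const.
- move=> _ _ [p Jp <-] [q Jq <-]; exists (p + q); last by rewrite hornerD.
  exact: poly_inD.
- move=> _ _ [p Bp <-] [q Jq <-]; exists (p * q); last by rewrite hornerM.
  exact: (poly_inM J0 JD JM).
Qed.

Definition valring V : Prop := forall x, x \inr V \/ x^-1 \inr V.

(** The maximal ideal of a valuation ring; [0] is listed apart because its
    inverse is [0] by convention. *)
Definition vmax V : set K := [set x | x = 0 \/ ~ x^-1 \inr V].

Lemma horner_inv p n x : x != 0 -> (size p <= n.+1)%N ->
  p.[x^-1] * x ^+ n = \sum_(i < n.+1) p`_i * x ^+ (n - i).
Proof.
move=> x0 sp; rewrite (horner_coef_wide _ sp) mulr_suml.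
apply: eq_bigr => i _; rewrite -mulrA; congr (_ * _).
by rewrite exprVn mulrC -expfB_cond ?subn_if_gt ?(negPf x0) // -ltnS ltn_ord.
Qed.

(** Division of [p] by the monic equation for [x] of degree [m] that a relation
    [q.[x^-1] = 1] amounts to, [1 - q`_0] being a unit. *)
Lemma reduce_relation B J x p q m n :
  proper_ideal_in B J -> (forall j, J j -> (1 - j)^-1 \inr B) -> x != 0 ->
  poly_in J p -> (size p <= n.+1)%N -> p.[x] = 1 ->
  poly_in J q -> (size q <= m.+1)%N -> q.[x^-1] = 1 -> (m <= n)%N ->
  exists p', [/\ poly_in J p', (size p' <= n)%N & p'.[x] = 1].
Proof.
move=> [JB J0 JD JM J1] unitB x0 Jp sp px Jq sq qx mn.
have u0 : 1 - q`_0 != 0.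
  by apply/eqP => /subr0_eq q01; apply: J1; rewrite q01; exact: Jq.
pose r := \poly_(i < m) (q`_(m - i) / (1 - q`_0)).
have rB : poly_in (subring_set B) r.
  apply: poly_in_poly; first exact: inr0.
  by move=> i _; apply: inrM; [exact: JB|exact: unitB].
have rx : r.[x] = x ^+ m.
  have := horner_inv x0 sq; rewrite qx mul1r (reindex_inj rev_ord_inj) /=.
  under eq_bigr => i _ do rewrite subSS subKn -1?ltnS ?ltn_ord //.
  rewrite big_ord_recr /= subnn => /eqP; rewrite -subr_eq => /eqP E.
  apply: (mulIf u0); rewrite [RHS]mulrBr mulr1 [x ^+ m * _]mulrC E.
  rewrite horner_poly mulr_suml; apply: eq_bigr => i _.
  by rewrite mulrAC divfK.
exists (\poly_(i < n) p`_i + (p`_n)%:P * ('X^(n - m) * r)); split.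
- apply: poly_inD => //; first exact: poly_in_poly.
  rewrite mulrC; apply: (poly_inM J0 JD JM); last exact: poly_inC.
  apply: (poly_inM _ _ _ (poly_inXn B _) rB); first exact: inr0.
    exact: inrD.
  exact: inrM.
- rewrite (leq_trans (size_polyD _ _)) // geq_max size_poly /=.
  rewrite mul_polyC (leq_trans (size_scale_leq _ _)) // mulrC.
  rewrite (leq_trans (size_polyMleq _ _)) // size_polyXn addnS /=.
  by rewrite (leq_trans (leq_add (size_poly _ _) (leqnn _))) // subnKC.
- rewrite hornerD hornerM hornerC hornerM hornerXn rx -exprD subnK //.
  rewrite horner_poly -[RHS]px (horner_coef_wide _ sp).
  by rewrite big_ord_recr.
Qed.

Section MaximalPair.
Variables (B : subring K) (J : set K).
Hypothesis JP : proper_ideal_in B J.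
Hypothesis maxB : forall x, ~ evals J x 1 -> x \inr B.

(** Adjoining [y = (1 - j)^-1] cannot make [J] improper: clearing denominators
    in a relation in [y] would put a power of [1 - j], which is [1] modulo [J],
    into [J]. *)
Lemma max_pair_unit j : J j -> (1 - j)^-1 \inr B.
Proof.
have [JB J0 JD JM J1] := JP => Jj; apply: maxB => -[p Jp py].
have y0 : 1 - j != 0.
  by apply/eqP => /subr0_eq j1; apply: J1; rewrite j1.
have By : 1 - j \inr B by apply: inrB; [exact: inr1|exact: JB].
have Jy : J ((1 - j) ^+ size p).
  rewrite -[X in J X]mul1r -{1}py horner_inv //.
  by apply: ideal_sum => // i _; rewrite mulrC; apply: JM; first exact: inrX.
apply: J1; rewrite -[1](subrK ((1 - j) ^+ size p)); apply: JD => //.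
rewrite -opprB subrX1 -mulNr opprB subKr mulrC; apply: JM => //.
apply: (big_ind (fun z => z \inr B)); [exact: inr0|exact: inrD|].
by move=> i _; exact: inrX.
Qed.

Lemma max_pair_valring : valring B.
Proof.
have JBB := JP; case: (JBB) => [JB J0 JD JM J1] x.
apply: contrapT => /not_orP[xB xVB].
have rel z : ~ z \inr B -> exists2 p, poly_in J p & p.[z] = 1.
  move=> zB; apply: contrapT => nz; apply/zB/maxB => -[p Jp pz].
  by apply: nz; exists p.
have x0 : x != 0 by apply/eqP => x0; apply: xB; rewrite x0; exact: inr0.
have xV0 : x^-1 != 0 by rewrite invr_eq0.
have [p Jp px] := rel _ xB; have [q Jq qx] := rel _ xVB.
(* Of two relations for [x] and [x^-1], the longer one is always reducible. *)
suff descent k : forall m n p q, (m + n <= k)%N ->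
    poly_in J p -> (size p <= n)%N -> p.[x] = 1 ->
    poly_in J q -> (size q <= m)%N -> q.[x^-1] = 1 -> False.
  exact: (descent _ (size q) (size p) p q).
have nonconst r z : r.[z] = 1 -> ~ (size r <= 0)%N.
  rewrite leqn0 size_poly_eq0 => rz /eqP r0; move: rz.
  by rewrite r0 horner0 => /esym/eqP; rewrite oner_eq0.
elim: k => [|k IH] [|m] [|n] f g //= kmn Jf sf fx Jg sg gx;
  try by [case: (nonconst _ _ fx sf) | case: (nonconst _ _ gx sg)].
have [mn|nm] := leqP m n.
  have [f' [Jf' sf' fx']] :=
    reduce_relation JBB max_pair_unit x0 Jf sf fx Jg sg gx mn.
  by apply: (IH m.+1 n f' g) => //; move: kmn; rewrite addnS ltnS.
have fx2 : f.[x^-1^-1] = 1 by rewrite invrK.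
have [g' [Jg' sg' gx']] :=
  reduce_relation JBB max_pair_unit xV0 Jg sg gx Jf sf fx2 (ltnW nm).
by apply: (IH m n.+1 f g').
Qed.

End MaximalPair.

(** Chevalley: among the pairs (ring, proper ideal) extending [(A, I)], a
    maximal one is a valuation ring with its maximal ideal. *)
Lemma valring_extension A I : proper_ideal_in A I ->
  exists V, [/\ valring V, subring_set A `<=` subring_set V & I `<=` vmax V].
Proof.
move=> AI.
pose ext (c : subring K * set K) := [/\ subring_set A `<=` subring_set c.1,
  I `<=` c.2 & proper_ideal_in c.1 c.2].
pose le (c d : {c | ext c}) := `[< subring_set (sval c).1 `<=`
  subring_set (sval d).1 /\ (sval c).2 `<=` (sval d).2 >].
have c0P : ext (A, I) by split.
have [||C totC|[[B J] BJ] maxBJ] := @ZL_preorder _ (exist _ _ c0P) le.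
- by move=> c; apply/asboolP; split.
- move=> d c e /asboolP[cd1 cd2] /asboolP[de1 de2]; apply/asboolP.
  by split=> x; [move=> /cd1 /de1|move=> /cd2 /de2].
- have [[c1 Cc1]|C0] := pselect (C !=set0); last first.
    by exists (exist _ _ c0P) => c Cc; case: C0; exists c.
  pose UB := \bigcup_(c in C) subring_set (sval c).1.
  pose UJ := \bigcup_(c in C) (sval c).2.
  have CE c : C c -> ext (sval c) by move=> _; exact: (svalP c).
  have dir c d : C c -> C d -> exists e, [/\ C e, le c e & le d e].
    by move=> Cc Cd; have [cd|dc] := totC _ _ Cc Cd; [exists d|exists c];
       split=> //; apply/asboolP; split.
  have UBr : subring_closed (mem UB).
    apply: subring_closedI.
    - by exists c1 => //; exact: inr1.
    - move=> x y [c Cc cx] [d Cd dy].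
      have [e [Ce /asboolP[ce _] /asboolP[de _]]] := dir _ _ Cc Cd.
      by exists e => //; apply: inrB; [exact: ce|exact: de].
    - move=> x y [c Cc cx] [d Cd dy].
      have [e [Ce /asboolP[ce _] /asboolP[de _]]] := dir _ _ Cc Cd.
      by exists e => //; apply: inrM; [exact: ce|exact: de].
  have UP : ext (Subring UBr, UJ).
    have [Ac1 Ic1 [_ Jc0 _ _ _]] := CE _ Cc1.
    split=> /=.
    - by move=> x /Ac1; exists c1.
    - by move=> x /Ic1; exists c1.
    - split.
      + move=> x [c Cc cx]; exists c => //.
        by have [_ _ [cB _ _ _ _]] := CE _ Cc; exact: cB.
      + by exists c1.
      + move=> x y [c Cc cx] [d Cd dy].
        have [e [Ce /asboolP[_ ce] /asboolP[_ de]]] := dir _ _ Cc Cd.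
        have [_ _ [_ _ eD _ _]] := CE _ Ce.
        by exists e => //; apply: eD; [exact: ce|exact: de].
      + move=> b x [c Cc cb] [d Cd dx].
        have [e [Ce /asboolP[ce _] /asboolP[_ de]]] := dir _ _ Cc Cd.
        have [_ _ [_ _ _ eM _]] := CE _ Ce.
        by exists e => //; apply: eM; [exact: ce|exact: de].
      + by move=> [c Cc c1']; have [_ _ [_ _ _ _]] := CE _ Cc.
  exists (exist _ _ UP) => c Cc; apply/asboolP; split=> x cx /=; exists c => //.
have [/= AB IJ JP] := BJ; have [JB J0 JD JM J1] := JP.
have maxB x : ~ evals J x 1 -> x \inr B.
  move=> nJ1; have adjP : ext (adjoin B x, evals J x).
    split=> /=; last exact: adjoin_ideal.
      by move=> y /AB; exact: adjoin_sub.
    by move=> y /IJ; exact: evals_const.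
  have /asboolP[adjB _] : le (exist _ _ adjP) (exist _ _ BJ).
    apply: maxBJ; apply/asboolP.
    by split; [exact: adjoin_sub|exact: evals_const].
  exact/adjB/adjoin_gen.
exists B; split=> //; first exact: max_pair_valring JP maxB.
move=> x /IJ Jx; have [->|x0] := eqVneq x 0; [by left|right=> xVB].
by apply: J1; rewrite -(mulVf x0); exact: JM.
Qed.

End Subrings.

Section Valuations.
Variable K : fieldType.
Implicit Types (A B D V W : subring K) (S I J : set K) (x y z u : K).
Implicit Types (p q f : {poly K}).

(** [u] and then [u^-1] are adjoined; a relation in [u] and [u^-1] with
    coefficients in [J] becomes, after clearing denominators, one that is
    excluded. *)
Lemma valring_extension_unit A J u : proper_ideal_in A J ->
  (forall p n, poly_in J p -> p.[u] <> u ^+ n) ->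
  exists W, [/\ valring W, subring_set A `<=` subring_set W, J `<=` vmax W,
    u \inr W & u^-1 \inr W].
Proof.
move=> AJ norel; have [JA J0 JD JM J1] := AJ.
have [->|u0] := eqVneq u 0.
  have [W [vW AW JW]] := valring_extension AJ.
  by exists W; split=> //; rewrite ?invr0; exact: inr0.
have AJu : proper_ideal_in (adjoin A u) (evals J u).
  by apply: adjoin_ideal => // -[p Jp pu]; apply: (norel p 0%N).
have AJuu : proper_ideal_in (adjoin (adjoin A u) u^-1)
    (evals (evals J u) u^-1).
  apply: adjoin_ideal => // -[q Jq qu].
  have /choice[c cP] : forall i, exists p, poly_in J p /\ p.[u] = q`_i.
    by move=> i; have [p Jp pu] := Jq i; exists p.
  apply: (norel (\sum_(i < (size q).+1) c i * 'X^(size q - i)) (size q)).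
    apply: (big_ind (fun p => poly_in J p)).
    - by move=> i; rewrite coef0.
    - by move=> p r; exact: poly_inD.
    - move=> i _; rewrite mulrC.
      by apply: (poly_inM J0 JD JM); [exact: poly_inXn|exact: (cP i).1].
  have := horner_inv u0 (leqnSn (size q)); rewrite qu mul1r => ->.
  rewrite horner_sum; apply: eq_bigr => i _.
  by rewrite hornerM hornerXn (cP i).2.
have [W [vW AW JW]] := valring_extension AJuu.
exists W; split=> //.
- by move=> x Ax; apply/AW/adjoin_sub/adjoin_sub.
- have [_ Ju0 _ _ _] := AJu.
  by move=> x Jx; apply: JW; apply: evals_const => //; exact: evals_const.
- exact/AW/adjoin_sub/adjoin_gen.
- exact/AW/adjoin_gen.
Qed.

Lemma vmax0 V : vmax V 0. Proof. by left. Qed.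

Lemma vmax1 V : ~ vmax V 1.
Proof.
by case=> [/eqP|]; [rewrite oner_eq0|rewrite invr1; case; exact: inr1].
Qed.

Lemma vmax_inr V x : valring V -> vmax V x -> x \inr V.
Proof. by move=> vV [->|nx]; [exact: inr0|case: (vV x)]. Qed.

Lemma vmaxM V x y : x \inr V -> vmax V y -> vmax V (x * y).
Proof.
move=> xV [->|ny]; first by rewrite mulr0; exact: vmax0.
have [->|x0] := eqVneq x 0; first by rewrite mul0r; exact: vmax0.
right=> xyV; apply: ny; rewrite -(mulKf x0 y^-1) mulrCA -invfM.
exact: inrM.
Qed.

Lemma vmaxD V x y : valring V -> vmax V x -> vmax V y -> vmax V (x + y).
Proof.
move=> vV mx my; have [->|x0] := eqVneq x 0; first by rewrite add0r.
have [->|y0] := eqVneq y 0; first by rewrite addr0.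
have [xy|] := vV (x / y).
  have -> : x + y = (x / y + 1) * y by rewrite mulrDl mul1r divfK.
  by apply: vmaxM => //; apply: inrD => //; exact: inr1.
rewrite invf_div => yx.
have -> : x + y = (1 + y / x) * x by rewrite mulrDl mul1r divfK.
by apply: vmaxM => //; apply: inrD => //; exact: inr1.
Qed.

Lemma vmaxN V x : vmax V x -> vmax V (- x).
Proof. by rewrite -mulN1r; apply/vmaxM/inrN/inr1. Qed.

Lemma vmaxB V x y : valring V -> vmax V x -> vmax V y -> vmax V (x - y).
Proof. by move=> vV mx my; apply: vmaxD => //; exact: vmaxN. Qed.

Lemma vmax_ideal V : valring V -> proper_ideal_in V (vmax V).
Proof.
move=> vV; split; [by move=> x; exact: vmax_inr|exact: vmax0| | |exact: vmax1].
  by move=> x y; exact: vmaxD.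
by move=> x y; exact: vmaxM.
Qed.

Lemma notin_vmax V x : ~ vmax V x -> x != 0 /\ x^-1 \inr V.
Proof.
move=> nx; split; first by apply/eqP => x0; apply: nx; left.
by apply: contrapT => nV; apply: nx; right.
Qed.

Lemma notin_valring V x : ~ x \inr V -> vmax V x^-1.
Proof. by move=> nx; right; rewrite invrK. Qed.

Lemma vmax_unit V x : x != 0 -> x^-1 \inr V -> ~ vmax V x.
Proof. by move=> x0 xV [x0'|//]; rewrite x0' eqxx in x0. Qed.

Lemma vmax_anti V W : subring_set V `<=` subring_set W -> vmax W `<=` vmax V.
Proof. by move=> VW x [->|nx]; [left|right=> /VW]. Qed.

Lemma vmax_antiI V W : valring V -> valring W ->
  vmax V `<=` vmax W -> subring_set W `<=` subring_set V.
Proof.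
move=> vV vW VW x xW; apply: contrapT => xV.
have /VW mx := notin_valring xV.
have x0 : x != 0 by apply/eqP => x0; apply: xV; rewrite x0; exact: inr0.
by apply: (@vmax1 W); rewrite -(mulfV x0); exact: vmaxM.
Qed.

Lemma vmax_prime V x y : x \inr V -> vmax V (x * y) -> vmax V x \/ vmax V y.
Proof.
move=> xV mxy; apply: contrapT => /not_orP[/notin_vmax[x0 xiV] ny].
by apply: ny; rewrite -(mulKf x0 y); exact: vmaxM.
Qed.

Lemma vmax_exp V x n : valring V -> vmax V (x ^+ n) -> vmax V x.
Proof.
move=> vV mx; apply: contrapT => /notin_vmax[x0 xV].
apply: (vmax_unit _ _ mx); first by rewrite expf_neq0.
by rewrite -exprVn; exact: inrX.
Qed.

Lemma zar_setP S V : zar_set S V <-> S `<=` subring_set V /\ valring V.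
Proof.
split=> [[SV vV qV]|[SV vV]].
  by split=> // x; apply: vV; rewrite qV.
split=> //.
apply/seteqP; split=> // x _; have [/inr_sub[v <-]|/inr_sub[v vx]] := vV x.
  by exists v, 1; rewrite oner_neq0 rmorph1 divr1.
have [x0|x0] := eqVneq x 0.
  by exists 0, 1; rewrite oner_neq0 rmorph0 mul0r.
exists 1, v; rewrite rmorph1 vx invrK mul1r; split=> //.
apply/eqP => v0; move: vx; rewrite v0 rmorph0 => /esym/eqP.
by rewrite invr_eq0 (negPf x0).
Qed.

Lemma zar_min_below S V : zar_set S V ->
  exists2 W, zar_min_set S W & subring_set W `<=` subring_set V.
Proof.
move=> SV; pose T := {W | zar_set S W /\ subring_set W `<=` subring_set V}.
pose le (W1 W2 : T) := `[< subring_set (sval W2) `<=` subring_set (sval W1) >].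
have V0 : zar_set S V /\ subring_set V `<=` subring_set V by split.
have [||C totC|[W [SW WV]] minW] := @ZL_preorder T (exist _ V V0) le.
- by move=> W; apply/asboolP.
- by move=> W1 W2 W3 /asboolP h12 /asboolP h23; apply/asboolP => x /h23 /h12.
- have [[W1 CW1]|C0] := pselect (C !=set0); last first.
    by exists (exist _ V V0) => W CW; case: C0; exists W.
  pose UC := \bigcap_(W in C) subring_set (sval W).
  have UCr : subring_closed (mem UC).
    apply: subring_closedI.
    - by move=> W _; exact: inr1.
    - by move=> x y xU yU W CW; apply: inrB; [exact: xU|exact: yU].
    - by move=> x y xU yU W CW; apply: inrM; [exact: xU|exact: yU].
  have UP : zar_set S (Subring UCr) /\
      subring_set (Subring UCr) `<=` subring_set V.
    split; last by move=> x /(_ _ CW1); exact: (svalP W1).2.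
    apply/zar_setP; split.
      move=> x Sx W CW.
      by have /zar_setP[SW _] := (svalP W).1; exact: SW.
    move=> x; apply: contrapT => /not_orP[].
    move=> /existsNP[W2 /not_implyP[CW2 xW2]].
    move=> /existsNP[W3 /not_implyP[CW3 xW3]].
    have [/asboolP h|/asboolP h] := totC _ _ CW2 CW3.
      have /zar_setP[_ /(_ x)[/h|]//] := (svalP W3).1.
    by have /zar_setP[_ /(_ x)[//|/h]] := (svalP W2).1.
  exists (exist _ (Subring UCr) UP) => W CW; apply/asboolP => x xU; exact: xU.
exists W => //; split=> // W' SW' W'W.
have W'P : zar_set S W' /\ subring_set W' `<=` subring_set V.
  by split=> // x /W'W /WV.
apply/seteqP; split=> //.
have /asboolP : le (exist _ W' W'P) (exist _ W (conj SW WV)).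
  by apply: minW; apply/asboolP.
exact.
Qed.

End Valuations.

(** * Prime ideals and centres of valuation rings *)

Section Primes.
Variables (K : fieldType) (D : subring K).
Implicit Types (V W : subring K) (P Q : Spec D) (S I J : set K).
Implicit Types (x y z u : K) (p q f : {poly K}).

(** Prime ideals are handled as subsets of [K], where they can be compared with
    the maximal ideals of the rings above [D]. *)
Definition prime_set P : set K := val @` spec_set P.

Lemma prime_set_val P (d : D) : prime_set P (val d) <-> spec_set P d.
Proof. by split=> [[e Pe /val_inj <-]|Pd]; [|exists d]. Qed.

Lemma prime_set_ideal P : proper_ideal_in D (prime_set P).
Proof.
have [[P0 /negP P1 PD] _] := spec_prime P.
have PDs (a u v : D) : spec_set P u -> spec_set P v -> spec_set P (a * u + v).
  by move=> /mem_set Pu /mem_set Pv; apply/set_mem/PD.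
split.
- by move=> _ [d _ <-]; exact: inr_val.
- by exists 0; [exact: set_mem|rewrite rmorph0].
- move=> _ _ [d Pd <-] [e Pe <-]; exists (d + e); last by rewrite rmorphD.
  by rewrite -[d]mul1r; exact: PDs.
- move=> _ _ /inr_sub[b <-] [d Pd <-]; exists (b * d); last by rewrite rmorphM.
  by rewrite -[_ * _]addr0; apply: PDs => //; exact: set_mem.
- have <- : val (1 : D) = 1 by rewrite rmorph1.
  by move=> /prime_set_val /mem_set.
Qed.

Lemma prime_setM P x y : x \inr D -> y \inr D ->
  prime_set P (x * y) -> prime_set P x \/ prime_set P y.
Proof.
have [_ pP] := spec_prime P.
move=> /inr_sub[a <-] /inr_sub[b <-]; rewrite -rmorphM => /prime_set_val.
by move=> /mem_set /pP /orP[] /set_mem h; [left|right]; exact/prime_set_val.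
Qed.

Lemma prime_setX P x n : x \inr D -> prime_set P (x ^+ n) -> prime_set P x.
Proof.
move=> xD; have [_ _ _ _ P1] := prime_set_ideal P.
elim: n => [//|n IH]; rewrite exprS => /prime_setM[]//; exact: inrX.
Qed.

Lemma prime_set_neq0 P x : ~ prime_set P x -> x != 0.
Proof.
have [_ P0 _ _ _] := prime_set_ideal P.
by move=> nPx; apply/eqP => x0; apply: nPx; rewrite x0.
Qed.

Lemma prime_set_inj P Q : prime_set P = prime_set Q -> P = Q.
Proof.
move=> PQ; apply/val_inj/seteqP; split=> d.
  by move=> /prime_set_val; rewrite PQ => /prime_set_val.
by move=> /prime_set_val; rewrite -PQ => /prime_set_val.
Qed.

Lemma prime_set_exists J : proper_ideal_in D J ->
  (forall x y, x \inr D -> y \inr D -> J (x * y) -> J x \/ J y) ->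
  exists P, prime_set P = J.
Proof.
move=> [JD J0 JA JM J1] Jprime; pose C : set D := [set d | J (val d)].
have CP : prime_ideal C.
  split; last first.
    move=> u v /set_mem uv; have : J (val u * val v) by rewrite -rmorphM.
    move=> /(Jprime _ _ (inr_val u) (inr_val v)) Juv.
    by apply/orP; case: Juv => h; [left|right]; exact/mem_set.
  split.
  - by apply/mem_set; rewrite -[C 0]/(J (val 0)) rmorph0.
  - by apply/negP => /set_mem; rewrite -[C 1]/(J (val 1)) rmorph1.
  - move=> a u v /set_mem Ju /set_mem Jv; apply/mem_set.
    rewrite -[C _]/(J (val (a * u + v))) rmorphD rmorphM.
    by apply: JA => //; apply: JM => //; exact: inr_val.
exists (exist _ C (asboolT CP)); apply/seteqP; split=> [_ [d Cd <-] //|x Jx].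
by have [d dx] := inr_sub (JD _ Jx); exists d => //; rewrite -dx in Jx.
Qed.

Lemma localizationP P x : x \inr localization P <->
  exists a s, [/\ a \inr D, s \inr D, ~ prime_set P s & x = a / s].
Proof.
split=> [[a [s [nPs ->]]]|[_ [_ [/inr_sub[a <-] /inr_sub[s <-] nPs ->]]]].
  exists (val a), (val s); split=> //; [exact: inr_val|exact: inr_val|].
  by move=> /prime_set_val.
by exists a, s; split=> // /prime_set_val.
Qed.

Lemma localization_frac P a s : a \inr D -> s \inr D -> ~ prime_set P s ->
  a / s \inr localization P.
Proof. by move=> aD sD nPs; apply/localizationP; exists a, s. Qed.

Lemma sub_localization P : subring_set D `<=` subring_set (localization P).
Proof.
move=> x xD; rewrite -[x]divr1; have [_ _ _ _ P1] := prime_set_ideal P.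
by apply: localization_frac => //; exact: inr1.
Qed.

(** The extension [P D_P] of [P], which is the maximal ideal of [D_P]. *)
Definition local_ideal P : set K := [set x | exists a s,
  [/\ prime_set P a, s \inr D, ~ prime_set P s & x = a / s]].

Lemma prime_set_local P : prime_set P `<=` local_ideal P.
Proof.
have [_ _ _ _ P1] := prime_set_ideal P.
by move=> a Pa; exists a, 1; split=> //; [exact: inr1|rewrite divr1].
Qed.

Lemma local_idealI P x : x \inr D -> local_ideal P x -> prime_set P x.
Proof.
move=> xD [a [s [Pa sD nPs xE]]].
have [//|] : prime_set P x \/ prime_set P s by
  apply: prime_setM => //; rewrite xE divfK //; exact: prime_set_neq0 nPs.
by [].
Qed.

Lemma local_ideal_ideal P : proper_ideal_in (localization P) (local_ideal P).
Proof.
have [PD P0 PA PM P1] := prime_set_ideal P.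
have nPM s t : s \inr D -> t \inr D -> ~ prime_set P s -> ~ prime_set P t ->
    ~ prime_set P (s * t) by move=> sD tD nPs nPt /prime_setM[].
split.
- by move=> _ [a [s [Pa sD nPs ->]]]; apply: localization_frac => //; exact: PD.
- exact: prime_set_local.
- move=> _ _ [a [s [Pa sD nPs ->]]] [b [t [Pb tD nPt ->]]].
  exists (a * t + b * s), (s * t); split; [|exact: inrM|exact: nPM|].
    by apply: PA; rewrite mulrC; exact: PM.
  by rewrite addf_div //; [exact: prime_set_neq0 nPs|exact: prime_set_neq0 nPt].
- move=> _ _ /localizationP[b [t [bD tD nPt ->]]] [a [s [Pa sD nPs ->]]].
  exists (b * a), (t * s); split; [exact: PM|exact: inrM|exact: nPM|].
  by rewrite mulf_div.
- by move=> /(local_idealI (@inr1 _ D)).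
Qed.

Lemma local_ideal_unit P x : x \inr localization P -> ~ local_ideal P x ->
  x != 0 /\ x^-1 \inr localization P.
Proof.
move=> /localizationP[a [s [aD sD nPs ->]]] nPx.
have nPa : ~ prime_set P a by move=> Pa; apply: nPx; exists a, s.
split; last by rewrite invf_div; exact: localization_frac.
by rewrite mulf_neq0 ?invr_eq0 ?(prime_set_neq0 nPa) ?(prime_set_neq0 nPs).
Qed.

Definition centered V P : Prop :=
  forall x, x \inr D -> (prime_set P x <-> vmax V x).

Lemma center_exists V : zar_set (subring_set D) V -> exists P, centered V P.
Proof.
move=> /zar_setP[DV vV]; have [_ m0 mD mM m1] := vmax_ideal vV.
have [|x y xD yD [mxy _]|P PE] := @prime_set_exists (vmax V `&` subring_set D).
- split.
  + by move=> x [].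
  + by split=> //; exact: inr0.
  + by move=> x y [mx xD] [my yD]; split; [exact: mD|exact: inrD].
  + by move=> b x bD [mx xD]; split; [exact/mM/mx/DV|exact: inrM].
  + by move=> [/m1].
- by have [mx|my] := vmax_prime (DV _ xD) mxy; [left|right].
by exists P => x xD; rewrite PE; split=> [[]|].
Qed.

Lemma localization_sub_centered V P : zar_set (subring_set D) V ->
  centered V P -> subring_set (localization P) `<=` subring_set V.
Proof.
move=> /zar_setP[DV vV] VP _ /localizationP[a [s [aD sD nPs ->]]].
apply: inrM; first exact: DV.
by have [] : s != 0 /\ s^-1 \inr V by apply: notin_vmax => /(VP s sD).
Qed.

Lemma local_ideal_centered V P : zar_set (subring_set D) V ->
  centered V P -> local_ideal P `<=` vmax V.
Proof.
move=> SV VP _ [a [s [Pa sD nPs ->]]]; rewrite mulrC.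
have [PD _ _ _ _] := prime_set_ideal P.
have [_ vV] := (zar_setP _ _).1 SV.
apply: vmaxM; last exact/(VP a (PD _ Pa)).
by have [] : s != 0 /\ s^-1 \inr V by apply: notin_vmax => /(VP s sD).
Qed.

(** A valuation ring dominating [D_P] is centred on [P]. *)
Lemma centered_exists P : exists2 V, zar_set (subring_set D) V & centered V P.
Proof.
have [V [vV LV IV]] := valring_extension (local_ideal_ideal P).
have SV : zar_set (subring_set D) V.
  by apply/zar_setP; split=> // x xD; exact/LV/sub_localization.
exists V => // x xD; split=> [Px|mx]; first exact/IV/prime_set_local.
apply: contrapT => nPx; apply: (vmax_unit (prime_set_neq0 nPx) _ mx).
by rewrite -[_^-1]mul1r; apply/LV/localization_frac => //; exact: inr1.
Qed.

Lemma centered_anti V W P Q : subring_set W `<=` subring_set V ->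
  centered V P -> centered W Q -> prime_set P `<=` prime_set Q.
Proof.
have [PD _ _ _ _] := prime_set_ideal P.
move=> WV VP WQ x Px; have xD := PD _ Px.
by apply/(WQ x xD)/(vmax_anti WV)/(VP x xD).
Qed.

Lemma prime_set_sub P Q : prime_set P `<=` prime_set Q <->
  spec_set P `<=` spec_set Q.
Proof.
split=> [PQ d Pd|PQ _ [d Pd <-]]; first exact/prime_set_val/PQ/prime_set_val.
exact/prime_set_val/PQ.
Qed.

Lemma Max_eq (P Q : Spec D) : Max D P -> prime_set P `<=` prime_set Q -> Q = P.
Proof.
move=> [_ maxP] /prime_set_sub PQ; apply: prime_set_inj; rewrite /prime_set.
by rewrite (maxP _ _ PQ) //; have [] := spec_prime Q.
Qed.

Section LocalRing.
Variable m : set K.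
Hypothesis Dm : proper_ideal_in D m.
Hypothesis unitD : forall x, x \inr D -> ~ m x -> x^-1 \inr D.

Lemma local_ring_sub P : prime_set P `<=` m.
Proof.
have [PD P0 _ PM P1] := prime_set_ideal P.
move=> x Px; apply: contrapT => nmx; have xD := PD _ Px.
have x0 : x != 0.
  by apply/eqP => x0; apply: nmx; rewrite x0; case: Dm.
by apply: P1; rewrite -(mulVf x0); apply: PM => //; exact: unitD.
Qed.

Lemma local_ring_Max : exists2 N : Spec D, Max D N & prime_set N = m.
Proof.
have [mD m0 mA mM m1] := Dm.
have [x y xD yD mxy|N NE] := prime_set_exists Dm.
  have [mx|nmx] := pselect (m x); [by left|right].
  have x0 : x != 0 by apply/eqP => x0; apply: nmx; rewrite x0.
  by rewrite -(mulKf x0 y); apply: mM => //; exact: unitD.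
exists N => //; have [idN _] := spec_prime N; split=> // I idI NI.
apply/seteqP; split=> // d Id; apply/prime_set_val; rewrite NE.
apply: contrapT => nmd; have [/set_mem I0 /negP I1 ID] := idI.
have d0 : val d != 0 by apply/eqP => d0; apply: nmd; rewrite d0.
have [e eE] := inr_sub (unitD (inr_val d) nmd).
apply: I1; have -> : 1 = e * d + 0 :> D.
  apply: val_inj; transitivity (val e * val d); first by rewrite eE mulVf.
  by rewrite addr0 rmorphM.
by apply: ID; exact/mem_set.
Qed.

Lemma local_ring_MaxE (N : Spec D) : Max D N -> prime_set N = m.
Proof.
move=> maxN; have [N' _ N'm] := local_ring_Max; rewrite -N'm.
by congr prime_set; apply/esym/Max_eq => //; rewrite N'm; exact: local_ring_sub.
Qed.

End LocalRing.

(** If [I] were a larger ideal than the centre of [V], a valuation ring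
    extending the pair [D + m_V], [I + m_V] would lie strictly below [V]. *)
Lemma center_minimal V P : zar_min_set (subring_set D) V -> centered V P ->
  Max D P.
Proof.
move=> [SV minV] VP; have /zar_setP[DV vV] := SV.
have [mV m0 mD mM m1] := vmax_ideal vV.
have [idP _] := spec_prime P; split=> // I idI PI.
have [/set_mem I0 /negP I1 ID] := idI.
have IDs (a u v : D) : I u -> I v -> I (a * u + v).
  by move=> /mem_set Iu /mem_set Iv; apply/set_mem/ID.
pose B : set K := [set val d + m | d in [set: D] & m in vmax V].
have BE (d : D) m : vmax V m -> B (val d + m) by exists d => //; exists m.
have BR : subring_closed (mem B).
  apply: subring_closedI.
  - by rewrite -[1]addr0 -(rmorph1 (val : D -> K)); exact: BE.
  - move=> _ _ [d _ [m mm <-]] [e _ [n mn <-]].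
    rewrite opprD addrACA -rmorphB; apply: BE.
    by apply: mD => //; exact: vmaxN.
  - move=> _ _ [d _ [m mm <-]] [e _ [n mn <-]].
    rewrite mulrDl mulrDr -addrA -rmorphM; apply: BE.
    apply: mD; first by apply: mM => //; exact/DV/inr_val.
    rewrite mulrC; apply: mM => //.
    by apply: inrD; [exact/DV/inr_val|exact: mV].
pose J : set K := [set val d + m | d in I & m in vmax V].
have JE (d : D) m : I d -> vmax V m -> J (val d + m).
  by exists d => //; exists m.
have BJ : proper_ideal_in (Subring BR) J.
  split.
  - by move=> _ [d _ [m mm <-]]; exact: BE.
  - by rewrite -[0]addr0 -{1}(rmorph0 (val : D -> K)); exact: JE.
  - move=> _ _ [d Id [m mm <-]] [e Ie [n mn <-]].
    rewrite addrACA -rmorphD; apply: JE; last exact: mD.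
    by rewrite -[d]mul1r; exact: IDs.
  - move=> _ _ [d _ [m mm <-]] [e Ie [n mn <-]].
    rewrite mulrDl mulrDr -addrA -rmorphM; apply: JE.
      by rewrite -[_ * _]addr0; exact: IDs.
    apply: mD; first by apply: mM => //; exact/DV/inr_val.
    rewrite mulrC; apply: mM => //.
    by apply: inrD; [exact/DV/inr_val|exact: mV].
  - move=> [d Id [m mm E]]; apply: I1; apply/mem_set.
    have md : vmax V (val (1 - d)) by rewrite rmorphB rmorph1 -E addrC addKr.
    have Id1 : I (1 - d).
      by apply/PI/prime_set_val/(VP _ (inr_val _)).
    by rewrite -[1](subrK d) -[1 - d]mul1r; exact: IDs.
have [W [vW BW JW]] := valring_extension BJ.
have mVW : vmax V `<=` vmax W.
  move=> m mm; apply: JW; rewrite -[m]add0r -(rmorph0 (val : D -> K)).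
  exact: JE.
have SW : zar_set (subring_set D) W.
  apply/zar_setP; split=> // _ /inr_sub[d <-]; apply: BW.
  by rewrite -[val d]addr0; exact: BE.
have WV : W = V by apply/subring_ext/minV/(vmax_antiI vV vW).
apply/seteqP; split=> // d Id; apply/prime_set_val/(VP _ (inr_val d)).
by rewrite -WV; apply: JW; rewrite -[val d]addr0; exact: JE.
Qed.

(** A minimal valuation ring below one centred on [P] has a maximal centre
    containing [P]. *)
Lemma sub_Max P : exists2 M : Spec D, Max D M & prime_set P `<=` prime_set M.
Proof.
have [V SV VP] := centered_exists P; have [W minW WV] := zar_min_below SV.
have [M WM] := center_exists minW.1.
by exists M; [exact: center_minimal minW WM|exact: centered_anti WV VP WM].
Qed.

Lemma Max_centered_min P : Max D P ->
  exists2 W, zar_min_set (subring_set D) W & centered W P.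
Proof.
move=> maxP; have [V SV VP] := centered_exists P.
have [W minW WV] := zar_min_below SV; exists W => //.
have [Q WQ] := center_exists minW.1.
by rewrite -(Max_eq maxP (centered_anti WV VP WQ)).
Qed.

End Primes.

(** * Integrally closed rings *)

Section IntegrallyClosed.
Variables (K : fieldType) (D : subring K).
Hypothesis Dint : integrally_closed_in D.
Implicit Types (P : Spec D) (x y z u : K) (p q f g : {poly K}).

Lemma integrally_closed_root p z : p \is monic ->
  poly_in (subring_set D) p -> root p z -> z \inr D.
Proof.
move=> mp Dp pz; apply: Dint.
have /choice[c cP] : forall i, exists d : D, val d = p`_i.
  by move=> i; exact: inr_sub.
have sp0 : (0 < size p)%N by rewrite size_poly_gt0 monic_neq0.
have c1 : c (size p).-1 = 1.
  by apply: val_inj; rewrite cP rmorph1; exact: (monicP mp).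
have qp : map_poly (val : D -> K) (\poly_(i < size p) c i) = p.
  apply/polyP => i; rewrite coef_map coef_poly.
  case: ltnP => [_|spi]; first exact: cP.
  by rewrite nth_default //; exact: (rmorph0 (val : D -> K)).
exists (\poly_(i < size p) c i); last by rewrite qp.
by apply/monicP; rewrite lead_coef_poly ?c1 ?oner_neq0.
Qed.

Lemma integrally_closed_exp n z : (0 < n)%N -> z ^+ n \inr D -> z \inr D.
Proof.
move=> n0 zn; apply: (@integrally_closed_root ('X^n - (z ^+ n)%:P)).
- exact: monicXnsubC.
- apply: poly_inD; [exact: inrD|exact: poly_inXn|].
  apply: (poly_inN (B := D)); first exact: inrM.
  by apply: poly_inC => //; exact: inr0.
- by rewrite /root hornerD hornerN hornerXn hornerC subrr.
Qed.

(** For [c] the leading coefficient and [n + 1] the degree, [c ^ n * f(X / c)]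
    is a monic equation for [c * u]. *)
Lemma lead_coef_integral f u n : poly_in (subring_set D) f ->
  (size f <= n.+2)%N -> f.[u] = 0 -> f`_n.+1 * u \inr D.
Proof.
move=> Df sf fu; set c := f`_n.+1.
pose h := \poly_(i < n.+1) (f`_i * c ^+ (n - i)).
apply: (@integrally_closed_root ('X^(n.+1) + h)).
- rewrite monicE lead_coefDl ?lead_coefXn // size_polyXn ltnS.
  exact: size_poly.
- apply: poly_inD; [exact: inrD|exact: poly_inXn|].
  apply: poly_in_poly; first exact: inr0.
  by move=> i _; apply: inrM; [exact: Df|apply: inrX; exact: Df].
- apply/eqP; rewrite hornerD hornerXn horner_poly.
  transitivity (c ^+ n * f.[u]); last by rewrite fu mulr0.
  rewrite (horner_coef_wide _ sf) [in RHS]big_ord_recr /= -/c mulrDr addrC.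
  congr (_ + _); last by rewrite exprMn exprSr -mulrA.
  rewrite mulr_sumr; apply: eq_bigr => i _.
  have -> : c ^+ n = c ^+ (n - i) * c ^+ i by rewrite -exprD subnK // -ltnS.
  by rewrite exprMn; ring.
Qed.

(** Seidenberg's u, 1/u lemma, by induction on the degree: the leading
    coefficient [c] satisfies [c * u \inr D], so that [c * u] can be absorbed
    in the next coefficient. *)
Lemma root_outside_prime P f u : poly_in (subring_set D) f -> f.[u] = 0 ->
  ~ poly_in (prime_set P) f ->
  u \inr localization P \/ u^-1 \inr localization P.
Proof.
have [PD P0 PA PM P1] := prime_set_ideal P.
have [n] := ubnP (size f); elim: n f => // -[|n] IH f sf Df fu nPf.
  case: nPf => i; move: sf; rewrite ltnS leqn0 size_poly_eq0 => /eqP ->.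
  by rewrite coef0.
case: n IH sf => [|n] IH; rewrite ltnS => sf.
  case: nPf; rewrite (size1_polyC sf) => i; rewrite coefC; case: eqP => // _.
  by move: fu; rewrite {1}(size1_polyC sf) hornerC => ->.
have cuD := lead_coef_integral Df sf fu; set c := f`_n.+1 in cuD.
have [Pc|nPc] := pselect (prime_set P c); last first.
  left; rewrite -(mulKf (prime_set_neq0 nPc) u) mulrC.
  by apply: localization_frac => //; exact: Df.
pose b := c * u + f`_n; pose g := \poly_(i < n) f`_i + b *: 'X^n.
have gE i : g`_i = if (i < n)%N then f`_i else if i == n then b else 0.
  rewrite coefD coef_poly coefZ coefXn; case: ltngtP => _.
  - by rewrite mulr0 addr0.
  - by rewrite mulr0 addr0.
  - by rewrite mulr1 add0r.
have bD : b \inr D by apply: inrD.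
have Dg : poly_in (subring_set D) g.
  by move=> i; rewrite gE; do 2?case: ifP => // _; exact: inr0.
have gu : g.[u] = 0.
  rewrite -fu (horner_coef_wide _ sf) !big_ord_recr /= hornerD horner_poly.
  by rewrite hornerZ hornerXn /b -/c exprS; ring.
have sg : (size g < n.+2)%N.
  rewrite ltnS (leq_trans (size_polyD _ _)) // geq_max.
  rewrite (leq_trans (size_poly _ _)) //=.
  by rewrite (leq_trans (size_scale_leq _ _)) // size_polyXn.
have [Pg|nPg] := pselect (poly_in (prime_set P) g); last exact: (IH g).
have Pb : prime_set P b by have := Pg n; rewrite gE ltnn eqxx.
have nPfn : ~ prime_set P f`_n.
  move=> Pfn; apply: nPf => i; case: (ltngtP i n) => [lin|lni|->//].
    by have := Pg i; rewrite gE lin.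
  have [->//|nin] := eqVneq i n.+1.
  rewrite nth_default // (leq_trans sf) //.
  by rewrite ltn_neqAle eq_sym nin.
have nPcu : ~ prime_set P (c * u).
  move=> Pcu; apply: nPfn; rewrite -[f`_n](addKr (c * u)) addrC.
  by apply: PA => //; rewrite -mulN1r; apply: PM => //; apply/inrN/inr1.
right; have c0 : c != 0.
  by apply/eqP => c0; apply: nPcu; rewrite c0 mul0r.
have -> : u^-1 = c / (c * u) by rewrite invfM mulrA mulfV // mul1r.
by apply: localization_frac => //; exact: PD.
Qed.

Lemma valring_unit_outside P u :
  ~ u \inr localization P -> ~ u^-1 \inr localization P ->
  exists W, [/\ zar_set (subring_set D) W, prime_set P `<=` vmax W,
    u \inr W & u^-1 \inr W].
Proof.
have [PD P0 PA PM P1] := prime_set_ideal P.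
move=> nu nui.
have [|W [vW DW PW uW uiW]] :=
    valring_extension_unit (prime_set_ideal P) (u := u).
  move=> p n Pp pu.
  have [] // : u \inr localization P \/ u^-1 \inr localization P.
  apply: (@root_outside_prime P ('X^n - p)).
  - apply: poly_inD; [exact: inrD|exact: poly_inXn|].
    by apply: (poly_inN (B := D)); [exact: inrM|move=> i; apply/PD/Pp].
  - by rewrite hornerD hornerN hornerXn pu subrr.
  - move=> /(_ n); rewrite coefB coefXn eqxx => P1p; apply: P1.
    by rewrite -[1](subrK p`_n); apply: PA.
by exists W; split=> //; apply/zar_setP.
Qed.

End IntegrallyClosed.

(** * Noetherian spaces of minimal valuation rings *)

Section MinimalNoetherian.
Variables (K : fieldType) (D : subring K).
Implicit Types (P : Spec D) (V W : subring K) (x y z u : K).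

(** Values in [W_n] are in the ratio [v(x) = (n + 1/2) v(y)], so that [W_n] and
    the minimal valuation rings below it contain [y] and [y ^ (n+1) / x], but
    have [x / y ^ n] in their maximal ideal. *)
Lemma infinitely_many_slopes x y :
  (forall n, exists W, [/\ zar_set (subring_set D) W, vmax W y,
     y ^+ n.*2.+1 / x ^+ 2 \inr W & (y ^+ n.*2.+1 / x ^+ 2)^-1 \inr W]) ->
  x != 0 -> y != 0 -> ~ noetherian_on (zar_min_set (subring_set D)).
Proof.
move=> slope x0 y0 noe.
have [||N NP] := noe (fun n => contains [:: y; y ^+ n / x]).
- by move=> n; exact: open_contains.
- move=> n V Vn; have Vy : y \inr V by apply: Vn; rewrite !inE eqxx.
  have Vyx : y ^+ n / x \inr V by apply: Vn; rewrite !inE eqxx orbT.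
  move=> z; rewrite !inE => /orP[] /eqP -> //.
  by rewrite exprS -mulrA; exact: inrM.
have [W [SW my uW uiW]] := slope N.
have [V minV VW] := zar_min_below SW; have [/zar_setP[DV vV] _] := minV.
have /zar_setP[DW vW] := SW.
have mx1 : vmax W (y ^+ N.+1 / x).
  apply: (@vmax_exp _ _ _ 2) => //.
  have -> : (y ^+ N.+1 / x) ^+ 2 = y ^+ N.*2.+1 / x ^+ 2 * y.
    by rewrite expr_div_n -exprM muln2 doubleS exprSr mulrAC.
  exact: vmaxM.
have mx2 : vmax W (x / y ^+ N).
  apply: (@vmax_exp _ _ _ 2) => //.
  have -> : (x / y ^+ N) ^+ 2 = (y ^+ N.*2.+1 / x ^+ 2)^-1 * y.
    rewrite expr_div_n -exprM muln2 invf_div [y ^+ N.*2.+1]exprSr invfM.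
    by rewrite mulrA divfK.
  exact: vmaxM.
have VN1 : contains [:: y; y ^+ N.+1 / x] V.
  by move=> z; rewrite !inE => /orP[] /eqP ->; apply: vmax_inr => //;
     exact: (vmax_anti VW).
have /(_ (y ^+ N / x)) : contains [:: y; y ^+ N / x] V.
  by apply: (NP N.+1 (leqnSn N)); split.
rewrite !inE eqxx orbT => /(_ isT); rewrite -invf_div => xyV.
apply: (vmax_unit _ xyV); last exact: (vmax_anti VW).
by rewrite mulf_neq0 // invr_eq0 expf_neq0.
Qed.

End MinimalNoetherian.

Section NoetherianMinimal.
Variables (K : fieldType) (D : subring K).
Implicit Types (P : Spec D) (V W : subring K) (x y z u : K).

Lemma quotient_fieldP (R : subring K) x : quotient_field R x <->
  exists a b, [/\ a \inr R, b \inr R, b != 0 & x = a / b].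
Proof.
split=> [[a [b [b0 ->]]]|[_ [_ [/inr_sub[a <-] /inr_sub[b <-] b0 ->]]]].
  exists (val a), (val b); split; [exact: inr_val|exact: inr_val| |by []].
  by apply: contra_neq b0 => b0; apply: val_inj; rewrite b0 rmorph0.
by exists a, b; split=> //; apply: contra_neq b0 => ->; rewrite rmorph0.
Qed.

Lemma localization_exp P n z : integrally_closed_in D ->
  (0 < n)%N -> z ^+ n \inr localization P -> z \inr localization P.
Proof.
move=> Dint; case: n => // n _ /localizationP[b [t [bD tD nPt zE]]].
have t0 := prime_set_neq0 nPt.
rewrite -(mulKf t0 z) mulrC; apply: localization_frac => //.
apply: (integrally_closed_exp Dint (ltn0Sn n)).
rewrite exprMn zE exprSr -mulrA [t * _]mulrC divfK //.
by apply: inrM => //; exact: inrX.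
Qed.

Hypothesis Dint : integrally_closed_in D.
Hypothesis noeD : noetherian_on (zar_min_set (subring_set D)).

(** If neither [x] nor [y] were in [D_P], then, with [x * y] in [P] after
    scaling [x], no ratio [u = y ^ (2n+1) / x ^ 2] nor its inverse would be,
    because [y ^ (2n+3) = u * (x * y) ^ 2] and [x ^ (2n+3) = u^-1 * (x * y) ^
    (2n+1)]. So each of these ratios would be a unit of a valuation ring having
    [P], and then [y], in its maximal ideal. *)
Lemma mul_local_ideal P x y : local_ideal P (x * y) ->
  x \inr localization P \/ y \inr localization P.
Proof.
move=> [a [s [Pa sD nPs xyE]]]; apply: contrapT => /not_orP[nx ny].
have [PD P0 PA PM P1] := prime_set_ideal P.
have s0 := prime_set_neq0 nPs.
have [w wE] : {w | w = s * x} by exists (s * x).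
have wy : w * y = a by rewrite wE -mulrA xyE mulrC divfK.
have nw : ~ w \inr localization P.
  move=> wP; apply: nx; rewrite -(mulKf s0 x) -wE; apply: inrM wP.
  by rewrite -[_^-1]mul1r; apply: localization_frac => //; exact: inr1.
have w0 : w != 0 by apply/eqP => w0; apply: nw; rewrite w0; exact: inr0.
have y0 : y != 0 by apply/eqP => y0; apply: ny; rewrite y0; exact: inr0.
have aP : a \inr localization P by exact/sub_localization/PD.
apply: (infinitely_many_slopes _ w0 y0 noeD) => n.
set u := y ^+ n.*2.+1 / w ^+ 2.
have nu : ~ u \inr localization P.
  move=> uP; apply: ny; apply: (@localization_exp P n.*2.+3) => //.
  have -> : y ^+ n.*2.+3 = u * a ^+ 2.
    by rewrite /u -wy exprMn mulrA divfK ?expf_neq0 // -exprD addn2.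
  by apply: inrM => //; exact: inrX.
have nui : ~ u^-1 \inr localization P.
  move=> uP; apply: nw; apply: (@localization_exp P n.*2.+3) => //.
  have -> : w ^+ n.*2.+3 = u^-1 * a ^+ n.*2.+1.
    rewrite /u invf_div -wy exprMn mulrA [_ / _ * _]mulrAC divfK ?expf_neq0 //.
    by rewrite -exprD add2n.
  by apply: inrM => //; exact: inrX.
have [W [SW PW uW uiW]] := valring_unit_outside Dint nu nui.
exists W; split=> //.
have /zar_setP[DW vW] := SW.
apply: contrapT => /notin_vmax[_ yW].
have mw : vmax W w.
  have -> : w = y^-1 * a by rewrite -wy mulrCA mulVf // mulr1.
  by apply: vmaxM => //; exact: PW.
have : vmax W (y ^+ n.*2.+1).
  have -> : y ^+ n.*2.+1 = u * w * w.
    by rewrite /u -mulrA -expr2 divfK // expf_neq0.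
  by apply: vmaxM => //; apply: inrM => //; exact: vmax_inr.
move=> /(vmax_exp vW); exact: vmax_unit.
Qed.

Lemma quotient_field_noetherian : ~ is_field_ring D ->
  quotient_field D = setT.
Proof.
move=> /existsNP[a /not_implyP[a0 aN]].
have va0 : val a != 0.
  by apply: contra_neq a0 => a0; apply: val_inj; rewrite a0 rmorph0.
pose I : set K := [set b * val a | b in subring_set D].
have DI : proper_ideal_in D I.
  split.
  - by move=> _ [b bD <-]; apply: inrM => //; exact: inr_val.
  - by exists 0; [exact: inr0|rewrite mul0r].
  - move=> _ _ [b bD <-] [c cD <-].
    by exists (b + c); [exact: inrD|rewrite mulrDl].
  - by move=> b _ bD [c cD <-]; exists (b * c); [exact: inrM|rewrite mulrA].
  - move=> [_ /inr_sub[b <-] ba]; apply: aN; exists b; apply: val_inj.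
    by rewrite rmorphM mulrC rmorph1.
have [V [vV DV IV]] := valring_extension DI.
have [|P VP] := @center_exists _ D V; first exact/zar_setP.
have Pa : prime_set P (val a).
  apply/(VP _ (inr_val a))/IV; exists 1; [exact: inr1|by rewrite mul1r].
apply/seteqP; split=> // x _; apply/quotient_fieldP.
have frac z : z \inr localization P ->
    exists b c, [/\ b \inr D, c \inr D, c != 0 & z = b / c].
  by move=> /localizationP[b [c [bD cD /prime_set_neq0 c0 ->]]]; exists b, c.
have [->|x0] := eqVneq x 0.
  exists 0, 1; rewrite mul0r oner_neq0.
  by split=> //; [exact: inr0|exact: inr1].
have [||/frac[b [c [bD cD c0 xE]]]] := @mul_local_ideal P x (val a / x).
- by rewrite mulrCA divff // mulr1; exact: prime_set_local.
- exact: frac.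
have b0 : b != 0.
  apply: contra_neq va0 => b0; apply: (mulIf (invr_neq0 x0)).
  by rewrite xE b0 !mul0r.
exists (val a * c), b; split=> //; first by apply: inrM => //; exact: inr_val.
apply: (mulIf (invr_neq0 x0)); rewrite divff //.
apply: (mulfI va0); rewrite mulr1 mulrCA xE.
by rewrite -mulrA mulrCA; field; rewrite b0 c0.
Qed.

Section Localization.
Variable P : Spec D.
Let R : subring K := localization P.
Let m : set K := local_ideal P.

Lemma local_ideal_div y t : ~ y \inr R -> m t -> m (t / y).
Proof.
have [mR m0 mA mM m1] := local_ideal_ideal P.
move=> ny mt; have y0 : y != 0.
  by apply/eqP => y0; apply: ny; rewrite y0; exact: inr0.
have tyR : t / y \inr R.
  by have [] // := @mul_local_ideal P (t / y) y; rewrite divfK.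
apply: contrapT => /(local_ideal_unit tyR)[ty0 tyi]; apply: ny.
have t0 : t != 0 by apply: contraNneq ty0 => ->; rewrite mul0r.
by rewrite -[y](divfK t0) -invf_div; apply: inrM => //; exact: mR.
Qed.

(** From [x ^ 2 = (x * y) * (x / y)] when [y] is outside [D_P]. *)
Lemma localization_pvd : pseudo_valuation_domain R.
Proof.
have [mR m0 mA mM m1] := local_ideal_ideal P.
move=> Q x y _ _; rewrite -![_ @` _]/(prime_set Q).
have [QR Q0 QA QM Q1] := prime_set_ideal Q.
have Qm : prime_set Q `<=` m.
  move=> z Qz; apply: contrapT => /(local_ideal_unit (QR _ Qz))[z0 zi].
  by apply: Q1; rewrite -(mulVf z0); exact: QM.
have half z t : z \inr R -> prime_set Q (z * t) ->
    prime_set Q z \/ prime_set Q t.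
  move=> zR Qzt; have [tR|ntR] := pselect (t \inr R); first exact: prime_setM.
  have [mz|nmz] := pselect (m z); last first.
    have [z0 zi] := local_ideal_unit zR nmz.
    by right; rewrite -(mulKf z0 t); exact: QM.
  left; apply: (@prime_setX _ _ _ _ 2) => //.
  have t0 : t != 0 by apply/eqP => t0; apply: ntR; rewrite t0; exact: inr0.
  have -> : z ^+ 2 = z / t * (z * t) by rewrite mulrCA divfK // expr2.
  by apply: QM => //; apply: mR; exact: local_ideal_div.
move=> Qxy; have [|xR|yR] := @mul_local_ideal P x y; first exact: Qm.
  exact: half.
by apply/or_comm/half; rewrite 1?mulrC.
Qed.

Lemma colon_subproof :
  subring_closed (mem [set x | forall t, m t -> m (x * t)]).
Proof.
have [mR m0 mA mM m1] := local_ideal_ideal P.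
apply: subring_closedI => [t|x y hx hy t mt|x y hx hy t mt].
- by rewrite mul1r.
- rewrite mulrBl; apply: mA; first exact: hx.
  by rewrite -mulN1r; apply: mM; [exact/inrN/inr1|exact: hy].
- by rewrite -mulrA; apply/hx/hy.
Qed.

(** The ring [(m : m)]; [mul_local_ideal] makes it a valuation ring, and the one
    associated to [D_P]. *)
Definition colon : subring K := Subring colon_subproof.

Lemma colon_sub : subring_set R `<=` subring_set colon.
Proof.
by move=> x xR t; have [_ _ _ mM _] := local_ideal_ideal P; exact: mM.
Qed.

Lemma colon_valring : valring colon.
Proof.
move=> x; have [xR|nx] := pselect (x \inr R); first by left; exact: colon_sub.
by right=> t mt; rewrite mulrC; exact: local_ideal_div.
Qed.

Lemma vmax_colon : vmax colon = m.
Proof.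
have [mR m0 mA mM m1] := local_ideal_ideal P.
apply/seteqP; split=> x; last first.
  move=> mx; have [->|x0] := eqVneq x 0; [by left|right=> /(_ x mx)].
  by rewrite mulVf.
move=> [->//|/existsNP[t /not_implyP[mt nxt]]].
have x0 : x != 0 by apply: contra_not_neq nxt => ->; rewrite invr0 mul0r.
have [|xR|xtR] := @mul_local_ideal P x (x^-1 * t).
- by rewrite mulVKf.
- apply: contrapT => nmx; apply: nxt; apply: mM => //.
  exact: (local_ideal_unit xR nmx).2.
- have [xt0 xti] := local_ideal_unit xtR nxt.
  have t0 : t != 0 by apply: contraNneq xt0 => ->; rewrite mulr0.
  have -> : x = (x^-1 * t)^-1 * t by rewrite invfM invrK divfK.
  exact: mM.
Qed.

End Localization.

End NoetherianMinimal.

(** * Valuation rings below the associated valuation ring *)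

Section BelowAssociated.
Variables (K : fieldType) (D : subring K).
Implicit Types (V W : subring K) (x y z u : K) (p q f : {poly K}).

(** In a relation in [z^-1] whose coefficients lie in [m_V] or outside [m_W],
    the leading one outside [m_W] would dominate, as [z] is in [m_W]. *)
Lemma dominant_coef V W f z : valring V -> valring W ->
  vmax V `<=` vmax W -> vmax W z -> z \inr V -> z^-1 \inr V -> z != 0 ->
  (forall i, f`_i \inr W /\ (vmax V f`_i \/ ~ vmax W f`_i)) ->
  vmax V f.[z^-1] -> poly_in (vmax V) f.
Proof.
move=> vV vW mVW mz zV ziV z0.
have [n] := ubnP (size f); elim: n f => // n IH f; rewrite ltnS => sf fW mf.
case: n IH sf => [|n] IH sf.
  move=> i; move: sf; rewrite leqn0 size_poly_eq0 => /eqP ->.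
  by rewrite coef0; exact: vmax0.
pose g := \poly_(i < n) f`_i.
have fE : f.[z^-1] = g.[z^-1] + f`_n * z^-1 ^+ n.
  by rewrite (horner_coef_wide _ sf) big_ord_recr /= horner_poly.
have [mfn|nmfn] := (fW n).2.
  have mg : poly_in (vmax V) g.
    apply: IH.
    - by rewrite ltnS; exact: size_poly.
    - move=> i; rewrite coef_poly; case: ifP => // _.
      by split; [exact: inr0|left; exact: vmax0].
    - have -> : g.[z^-1] = f.[z^-1] - f`_n * z^-1 ^+ n by rewrite fE addrK.
      by apply: vmaxB => //; rewrite mulrC; apply: vmaxM => //; exact: inrX.
  move=> i; case: (ltngtP i n) => [lin|lni|->//].
    by have := mg i; rewrite coef_poly lin.
  by rewrite nth_default; [exact: vmax0|exact: leq_trans lni].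
case: nmfn.
have -> : f`_n = f.[z^-1] * z ^+ n - g.[z^-1] * z ^+ n.
  by rewrite fE mulrDl addrC addKr -mulrA -exprMn mulVf // expr1n mulr1.
apply: vmaxB => //.
  by apply: mVW; rewrite mulrC; apply: vmaxM => //; exact: inrX.
have sg : (size g <= n.+1)%N by rewrite leqW // size_poly.
rewrite (horner_inv z0 sg) big_ord_recr /= coef_poly ltnn mul0r addr0.
have [_ mW0 mWD _ _] := vmax_ideal vW.
apply: (big_ind (vmax W)) => // i _; rewrite coef_poly ltn_ord.
apply: vmaxM; first exact: (fW i).1.
rewrite -(subnSK (ltn_ord i)) exprSr; apply: vmaxM => //.
by apply: inrX; exact: vmax_inr.
Qed.

(** Below a valuation ring [V] with maximal centre, a chain [W' < W < V] yields
    [x] in [m_W] and [y] in [m_W'] which are independent modulo [m_V], with [x]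
    infinitely smaller than every power of [y]. *)
Lemma below_minimal (M : Spec D) V W :
  noetherian_on (zar_min_set (subring_set D)) ->
  Max D M -> zar_set (subring_set D) V -> centered V M ->
  zar_set (subring_set D) W -> subring_set W `<=` subring_set V ->
  W = V \/ zar_min_set (subring_set D) W.
Proof.
move=> noeD maxM SV VM SW WV; apply: contrapT => /not_orP[neWV nminW].
have [W' [SW' W'W neW'W]] : exists W', [/\ zar_set (subring_set D) W',
    subring_set W' `<=` subring_set W & W' <> W].
  apply: contrapT => nW'; apply: nminW; split=> // W' SW' W'W.
  apply: contrapT => ne; apply: nW'; exists W'; split=> // E.
  by apply: ne; rewrite E.
have pick (A B : subring K) : subring_set A `<=` subring_set B -> A <> B ->
    exists2 z, z \inr B & ~ z \inr A.
  move=> AB neAB; apply: contrapT => nz; apply: neAB; apply: subring_ext.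
  apply/seteqP; split=> // z zB; apply: contrapT => zA; apply: nz; by exists z.
have [xi xiV nxi] := pick _ _ WV neWV; have [yi yiW nyi] := pick _ _ W'W neW'W.
have [/zar_setP[DV vV] /zar_setP[DW vW]] := conj SV SW.
have /zar_setP[DW' vW'] := SW'.
have mVW := vmax_anti WV; have mWW' := vmax_anti W'W.
pose x := xi^-1; pose y := yi^-1.
have mx : vmax W x := notin_valring nxi.
have my : vmax W' y := notin_valring nyi.
have x0 : x != 0.
  by rewrite invr_eq0; apply/eqP => x0; apply: nxi; rewrite x0; exact: inr0.
have y0 : y != 0.
  by rewrite invr_eq0; apply/eqP => y0; apply: nyi; rewrite y0; exact: inr0.
have yW : y \inr W by apply/W'W/vmax_inr.
have yVW : y^-1 \inr W by rewrite /y invrK.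
have xVV : x^-1 \inr V by rewrite /x invrK.
have [M' W'M'] := center_exists SW'.
have M'E : M' = M.
  by apply: Max_eq maxM _; apply: centered_anti VM W'M' => z /W'W /WV.
rewrite {}M'E in W'M'.
have yW' : y \inr W' := vmax_inr vW' my.
have horner_inr p : poly_in (subring_set D) p -> p.[y] \inr W'.
  move=> Dp; rewrite horner_coef.
  apply: (big_ind (fun c => c \inr W')); [exact: inr0|exact: inrD|].
  by move=> i _; apply: inrM; [apply/DW'/Dp|exact: inrX].
(* Modulo [m_V], the coefficient of lowest degree outside [M] dominates in an
   element of [D[y]]. *)
have dich p : poly_in (subring_set D) p -> vmax V p.[y] \/ ~ vmax W p.[y].
  elim/poly_ind: p => [|p c IH] Dpc.
    by left; rewrite horner0; exact: vmax0.
  have Dp : poly_in (subring_set D) p.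
    by move=> i; have := Dpc i.+1; rewrite coefD coefMX coefC addr0.
  have Dc : c \inr D by have := Dpc 0%N; rewrite coefD coefMX coefC add0r.
  rewrite hornerMXaddC; have [Mc|nMc] := pselect (prime_set M c).
    have mc : vmax V c by apply/VM.
    have [mp|nmp] := IH Dp; [left|right].
      by apply: vmaxD => //; rewrite mulrC; apply: vmaxM => //; exact: WV.
    move=> mpc; apply: nmp; rewrite -[p.[y]](mulfK y0) mulrC.
    apply: vmaxM => //.
    by rewrite -[_ * y](addrK c); apply: vmaxB => //; exact: mVW.
  right=> /mWW' mpc; apply: nMc; apply/(W'M' _ Dc).
  rewrite -[c](addKr (p.[y] * y)) addrC; apply: vmaxB => //.
  by apply: vmaxM => //; exact: horner_inr.
have := infinitely_many_slopes _ x0 y0 noeD; apply => n.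
pose u := y ^+ n.*2.+1 / x ^+ 2; rewrite -/u.
have u0 : u != 0 by rewrite mulf_neq0 ?invr_eq0 ?expf_neq0.
have mui : vmax W u^-1.
  rewrite /u invf_div mulrC expr2 mulrA; apply: vmaxM => //.
  apply: inrM; last exact: vmax_inr.
  by rewrite -exprVn; exact: inrX.
have uV : u \inr V.
  apply: inrM; first by apply/inrX/WV.
  by rewrite -exprVn; exact: inrX.
pose A := adjoin D y; pose J := vmax W' `&` subring_set A.
have AW' : subring_set A `<=` subring_set W'.
  by move=> _ [p Dp <-]; exact: horner_inr.
have AJ : proper_ideal_in A J.
  have [_ m0 mD mM m1] := vmax_ideal vW'; split.
  - by move=> z [].
  - by split=> //; exact: inr0.
  - by move=> b c [mb bA] [mc cA]; split; [exact: mD|exact: inrD].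
  - by move=> b c bA [mc cA]; split; [exact/mM/mc/AW'|exact: inrM].
  - by move=> [/m1].
have [|T [vT AT JT uT uiT]] := valring_extension_unit AJ (u := u).
  move=> p k Jp pu; pose f := 'X^k - p.
  have fA : poly_in (subring_set A) f.
    apply: poly_inD; [exact: inrD|exact: poly_inXn|].
    by apply: (poly_inN (B := A)); [exact: inrM|move=> i; exact: (Jp i).2].
  have : poly_in (vmax V) f.
    apply: (@dominant_coef V W f u^-1) => //.
    - by apply: WV; exact: vmax_inr.
    - by rewrite invrK.
    - by rewrite invr_eq0.
    - move=> i; split; first exact/W'W/AW'/fA.
      by have [q Dq <-] := fA i; exact: dich.
    - by rewrite invrK hornerD hornerN hornerXn pu subrr; exact: vmax0.
  move=> /(_ k) /mVW /mWW'; rewrite coefB coefXn eqxx => m1p.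
  apply: (@vmax1 _ W'); rewrite -[1](subrK p`_k); apply: vmaxD => //.
  exact: (Jp k).1.
exists T; split=> //.
  by apply/zar_setP; split=> // z zD; apply/AT/adjoin_sub.
by apply: JT; split=> //; exact: adjoin_gen.
Qed.

End BelowAssociated.

Section ResidueField.
Variables (K : fieldType) (V : subring K) (N : Max V).
Implicit Types (W : subring K) (B : subring (residue_field N)).
Hypothesis vV : valring V.

Lemma prime_set_valring : prime_set (val N) = vmax V.
Proof.
apply: local_ring_MaxE; [exact: vmax_ideal| |exact: max_maximal].
by move=> x _ /notin_vmax[].
Qed.

Local Notation pi := (@residue_map _ N).

Lemma residue_map1 : pi 1 = 1. Proof. by rewrite /residue_map rmorph1. Qed.
Lemma residue_map0 : pi 0 = 0. Proof. by rewrite /residue_map rmorph0. Qed.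
Lemma residue_mapB : {morph pi : a b / a - b}.
Proof. by move=> a b; rewrite /residue_map rmorphB. Qed.
Lemma residue_mapM : {morph pi : a b / a * b}.
Proof. by move=> a b; rewrite /residue_map rmorphM. Qed.

Lemma residue_map_surj (a : residue_field N) : exists v, pi v = a.
Proof. by exists (repr a); rewrite /residue_map reprK. Qed.

Lemma residue_map_eq0 (v : V) : pi v = 0 <-> vmax V (val v).
Proof.
rewrite -prime_set_valring prime_set_val.
have E : (pi v == 0) = (v \in max_pred N).
  by rewrite -[v in RHS]subr0 Quotient.idealrBE -residue_map0.
split=> [/eqP|h]; first by rewrite E => /set_mem.
by apply/eqP; rewrite E; exact/mem_set.
Qed.

Lemma residue_map_inv (v w : V) : val w = (val v)^-1 -> pi w = (pi v)^-1.
Proof.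
have [v0|v0] := eqVneq (val v) 0.
  have -> : v = 0 by exact: val_inj.
  rewrite rmorph0 invr0 => w0; have -> : w = 0 by exact: val_inj.
  by rewrite residue_map0 invr0.
move=> wv; have vw : pi v * pi w = 1.
  rewrite -residue_mapM -residue_map1; congr pi; apply: val_inj.
  transitivity (val v * val w); first by rewrite rmorphM.
  by rewrite wv mulfV // rmorph1.
have pv0 : pi v != 0.
  by apply/eqP => p0; move/eqP: vw; rewrite p0 mul0r eq_sym oner_eq0.
by apply: (mulfI pv0); rewrite vw mulfV.
Qed.

Lemma residue_pull_subproof B :
  subring_closed (mem [set x | exists2 v : V, val v = x & pi v \inr B]).
Proof.
apply: subring_closedI.
- by exists 1; [rewrite rmorph1|rewrite residue_map1; exact: inr1].
- move=> _ _ [v <- vB] [w <- wB]; exists (v - w); first by rewrite rmorphB.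
  by rewrite residue_mapB; exact: inrB.
- move=> _ _ [v <- vB] [w <- wB]; exists (v * w); first by rewrite rmorphM.
  by rewrite residue_mapM; exact: inrM.
Qed.

(** The composite of the valuation ring [V] with a valuation ring of its residue
    field. *)
Definition residue_pull B : subring K := Subring (residue_pull_subproof B).

Lemma residue_push_subproof W :
  subring_closed (mem [set pi v | v in [set v : V | val v \inr W]]).
Proof.
apply: subring_closedI.
- exists 1; last exact: residue_map1.
  by rewrite /mkset rmorph1; exact: inr1.
- move=> _ _ [v vW <-] [w wW <-]; exists (v - w); last exact: residue_mapB.
  by rewrite /mkset rmorphB; exact: inrB.
- move=> _ _ [v vW <-] [w wW <-]; exists (v * w); last exact: residue_mapM.
  by rewrite /mkset rmorphM; exact: inrM.
Qed.

Definition residue_push W : subring (residue_field N) :=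
  Subring (residue_push_subproof W).

Lemma residue_pullP B (v : V) : val v \inr residue_pull B <-> pi v \inr B.
Proof. by split=> [[w /val_inj ->]|vB] //; exists v. Qed.

Lemma residue_pull_sub B : subring_set (residue_pull B) `<=` subring_set V.
Proof. by move=> _ [v <- _]; exact: inr_val. Qed.

Lemma residue_pushK W : vmax V `<=` subring_set W ->
  subring_set W `<=` subring_set V -> residue_pull (residue_push W) = W.
Proof.
move=> mW WV; apply/subring_ext/seteqP; split=> [_ [v <- [w wW wv]]|x xW].
  have mvw : vmax V (val (w - v)).
    by apply/residue_map_eq0; rewrite residue_mapB wv subrr.
  have -> : val v = val w - val (w - v) by rewrite rmorphB subKr.
  by apply: inrB => //; exact: mW.
have [v vx] := inr_sub (WV _ xW).
by exists v => //; exists v => //; rewrite /= vx.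
Qed.

Lemma zar_residue_pull (R : subring K) B : subring_set R `<=` subring_set V ->
  zar_set (residue_image R N) B -> zar_set (subring_set R) (residue_pull B).
Proof.
move=> RV /zar_setP[RB vB]; apply/zar_setP; split=> [x xR|x].
  have [v vx] := inr_sub (RV _ xR); exists v => //.
  by apply: RB; exists v => //; rewrite /= vx.
have m_pull z : vmax V z -> z \inr residue_pull B.
  move=> mz; have [v vz] := inr_sub (vmax_inr vV mz); exists v => //.
  by rewrite (residue_map_eq0 v).2 ?vz //; exact: inr0.
have [xV|/notin_valring/m_pull] := pselect (x \inr V); last by right.
have [xiV|/notin_valring/m_pull] := pselect (x^-1 \inr V); last first.
  by rewrite invrK; left.
have [[v vx] [w wx]] := conj (inr_sub xV) (inr_sub xiV).
have [vB'|vB'] := vB (pi v); [left|right].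
  by exists v.
by exists w => //; rewrite (residue_map_inv (v := v)) // wx vx.
Qed.

Lemma zar_residue_push (R W : subring K) : zar_set (subring_set R) W ->
  subring_set W `<=` subring_set V ->
  zar_set (residue_image R N) (residue_push W).
Proof.
move=> /zar_setP[RW vW] WV; apply/zar_setP; split=> [_ [v vR <-]|a].
  by exists v => //; exact: RW.
have [v <-] := residue_map_surj a; have [vW'|vW'] := vW (val v); [left|right].
  by exists v.
have [w wv] := inr_sub (WV _ vW').
by exists w; [rewrite /= wv|exact: residue_map_inv].
Qed.

Lemma open_residue_pull (U : set (subring K)) : open U ->
  open [set B | U (residue_pull B)].
Proof.
rewrite !subring_openE => oU B UB; have [s sB sU] := oU _ UB.
have /choice[c cP] : forall x, exists v : V, x \in s -> val v = x.
  move=> x; have [/sB[v vx _]|_] := boolP (x \in s); first by exists v.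
  by exists 0.
exists [seq pi (c x) | x <- s].
  move=> _ /mapP[x xs ->]; apply/residue_pullP; rewrite (cP x xs).
  exact: sB.
move=> B' sB'; apply: sU => x xs; rewrite -(cP x xs); apply/residue_pullP.
by apply: sB'; apply/mapP; exists x.
Qed.

Lemma open_residue_push (U : set (subring (residue_field N))) : open U ->
  exists2 O : set (subring K), open O &
    forall B, O (residue_pull B) <-> U B.
Proof.
move=> oU; exists [set W | exists2 s : seq V, contains (map val s) W &
    contains (map pi s) `<=` U].
  rewrite subring_openE => W [s sW sU].
  by exists (map val s) => // W' sW'; exists s.
move=> B; split=> [[s sB]|UB].
  apply=> _ /mapP[v vs ->]; apply/residue_pullP/sB/mapP; by exists v.
have [t tB tU] := oU _ UB; have [c cP] := choice residue_map_surj.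
have ct : map pi (map c t) = t.
  by rewrite -map_comp -[RHS]map_id; apply: eq_map => a; exact: cP.
exists (map c t); last by rewrite ct.
move=> _ /mapP[v vt ->]; apply/residue_pullP/tB; rewrite -ct.
by apply/mapP; exists v.
Qed.

End ResidueField.

(** * The centre map *)

Section Centre.
Variables (K : fieldType) (D : subring K).
Implicit Types (P Q M : Spec D) (V W : subring K) (x y z : K).

Definition fiber P : set (subring K) :=
  [set W | zar_set (subring_set D) W /\ centered W P].

Lemma open_nonzero (d : D) : open [set P : Spec D | ~ prime_set P (val d)].
Proof.
exists [set d]; apply/seteqP; split=> P /=.
  by move=> nPd sub; apply/nPd/prime_set_val/sub.
by move=> nsub /prime_set_val Pd; apply: nsub => _ ->.
Qed.

Lemma noetherian_centers (Y : set (Spec D)) (B : set (subring K)) :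
  (forall P, Y P -> exists2 W, B W & centered W P) ->
  noetherian_on B -> noetherian_on Y.
Proof.
move=> YB; apply: (noetherian_transfer (r := @centered K D)) => // O [E ->].
exists [set W : subring K | exists d : D,
  [/\ E d, val d != 0 & (val d)^-1 \inr W]].
  rewrite subring_openE => W [d [Ed d0 dW]]; exists [:: (val d)^-1].
    by move=> x; rewrite inE => /eqP ->.
  move=> W' W'd; exists d; split=> //; apply: W'd; exact: mem_head.
move=> W P _ WP; split=> [[d [Ed d0 dW]] /(_ d Ed) /prime_set_val|nEP].
  by move=> /(WP _ (inr_val d)); exact: vmax_unit.
apply: contrapT => nd; apply: nEP => d Ed; apply/prime_set_val.
apply/(WP _ (inr_val d)); apply: contrapT => /notin_vmax[d0 dW].
by apply: nd; exists d.
Qed.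

(** [F P] plays the role of the largest valuation ring centred on [P]; the last
    hypothesis makes [P] the only prime, near [P] in [Y], where a given element
    of [F P] can fail to be in every valuation ring centred there. *)
Lemma noetherian_of_centers (Y : set (Spec D)) (F : Spec D -> subring K) :
  noetherian_on Y ->
  (forall P, Y P -> [/\ subring_set (localization P) `<=` subring_set (F P),
    forall W, zar_set (subring_set D) W -> centered W P ->
      subring_set W `<=` subring_set (F P),
    noetherian_on (fiber P) &
    forall x, x \inr F P -> exists d : D, ~ prime_set P (val d) /\
      forall P', Y P' -> ~ prime_set P' (val d) -> P' <> P ->
        x \inr localization P']) ->
  noetherian_on [set W : subring K | zar_set (subring_set D) W /\
    exists2 P, Y P & centered W P].
Proof.
move=> noeY FP U oU Uup.
have near P (s : seq K) : Y P -> contains s (F P) -> exists d : D,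
    ~ prime_set P (val d) /\ forall P', Y P' -> ~ prime_set P' (val d) ->
    P' <> P -> contains s (localization P').
  move=> YP; have [_ _ _ iso] := FP _ YP.
  elim: s => [_|x s IH sF].
    exists 1; split=> //; rewrite rmorph1.
    by have [_ _ _ _] := prime_set_ideal P.
  have [d [nPd dP]] : exists d : D, ~ prime_set P (val d) /\
      forall P', Y P' -> ~ prime_set P' (val d) -> P' <> P ->
      x \inr localization P' by apply/iso/sF; exact: mem_head.
  have [|e [nPe eP]] := IH.
    by move=> y ys; apply: sF; rewrite inE ys orbT.
  exists (d * e); rewrite rmorphM; split.
    by move=> /prime_setM[]; do ?exact: inr_val.
  move=> P' YP' nP' neP'; have [_ _ _ PM _] := prime_set_ideal P'.
  have nd : ~ prime_set P' (val d).
    by move=> h; apply: nP'; rewrite mulrC; apply: PM => //; exact: inr_val.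
  have ne : ~ prime_set P' (val e).
    by move=> h; apply: nP'; apply: PM => //; exact: inr_val.
  move=> y; rewrite inE => /predU1P[->|]; [exact: dP|exact: eP].
(* [O n] is the largest open set of [Spec D] whose trace on [Y] has [F P] in
   [U n]; [near] makes this trace the full preimage of [U n]. *)
pose O n : set (Spec D) := \bigcup_(d in [set d : D | forall P, Y P ->
  ~ prime_set P (val d) -> U n (F P)]) [set P : Spec D | ~ prime_set P (val d)].
have OE n P : Y P -> (O n P <-> U n (F P)).
  move=> YP; split=> [[d dU nPd]|UP]; first exact: dU.
  have [s sF sU] := oU n _ UP; have [d [nPd dP]] := near _ _ YP sF.
  exists d => // P' YP' nP'd; have [->//|neP'] := pselect (P' = P).
  apply: sU; apply: contains_sub (dP _ YP' nP'd neP').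
  by have [] := FP _ YP'.
have [||N NP] := noeY O.
- by move=> n; apply: bigcup_open => d _; exact: open_nonzero.
- by move=> n P [d dU nPd]; exists d => // P' YP' /dU h; apply/Uup/h.
pose Y1 := Y `&` [set P : Spec D | U N (F P)].
have noeY1 : noetherian_on Y1 by apply: noetherian_onS noeY => P [].
have /choice[f fP] : forall P, exists d : D, Y1 P ->
    ~ prime_set P (val d) /\ forall P', Y P' -> ~ prime_set P' (val d) ->
    P' <> P -> U N (localization P').
  move=> P; have [[YP UP]|] := pselect (Y1 P); last by exists 0.
  have [s sF sU] := oU N _ UP; have [d [nPd dP]] := near _ _ YP sF.
  by exists d => _; split=> // P' YP' nP'd neP'; exact/sU/dP.
have [|l lY lcov] := noetherian_cover
    (O := fun P => [set Q : Spec D | ~ prime_set Q (val (f P))]) noeY1.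
  by move=> P /fP[nPf _]; split=> //; exact: open_nonzero.
have /choice[g gP] : forall P, exists k, Y P -> forall n, (k <= n)%N ->
    fiber P `&` U n `<=` U k.
  move=> P; have [YP|] := pselect (Y P); last by exists 0%N.
  by have [_ _ noeP _] := FP _ YP; have [k kP] := noeP U oU Uup; exists k.
exists (maxn N (\max_(P <- l) g P)) => n; rewrite geq_max => /andP[Nn gn].
move=> W [[SW [P YP WP]] UW].
have [locF belowF _ _] := FP _ YP.
have UNF : U N (F P).
  apply/(OE N P YP)/(NP n Nn); split=> //; apply/(OE n P YP).
  by apply: open_sub (oU n) UW _; exact: belowF.
have [|Q Ql /= nPfQ] := lcov P; first by split.
have [PQ|neP] := pselect (P = Q).
  have gQ : (g P <= \max_(P <- l) g P)%N by rewrite PQ; exact: leq_bigmax_seq.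
  apply: (ascending_le Uup (leq_trans gQ (leq_maxr N _))).
  by apply: (gP P YP n (leq_trans gQ gn)).
apply: (ascending_le Uup (leq_maxl N _)).
apply: open_sub (oU N) ((fP _ (lY _ Ql)).2 _ YP nPfQ neP) _.
exact: localization_sub_centered.
Qed.

Section Associated.
Variables (M : Spec D) (V : subring K).
Hypotheses (maxM : Max D M) (SV : zar_set (subring_set D) V).
Hypothesis mV : vmax V = local_ideal M.

Lemma associated_centered : centered V M.
Proof.
by move=> x xD; rewrite mV; split; [exact: prime_set_local|exact: local_idealI].
Qed.

Lemma localization_anti P Q : prime_set P `<=` prime_set Q ->
  subring_set (localization Q) `<=` subring_set (localization P).
Proof.
move=> PQ _ /localizationP[a [s [aD sD nQs ->]]].
by apply: localization_frac => // /PQ.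
Qed.

Lemma mul_associated t x : prime_set M t -> x \inr V ->
  t * x \inr localization M.
Proof.
move=> Mt xV; have [+ _ _ _ _] := local_ideal_ideal M; apply.
by rewrite -mV mulrC; apply: vmaxM => //; rewrite mV; exact: prime_set_local.
Qed.

(** With [t] in [M] outside [P], each [x = t * x / t] in [V] is in [D_P]. *)
Lemma localization_valring P : prime_set P `<=` prime_set M -> P <> M ->
  valring (localization P).
Proof.
move=> PM neP; have [t Mt nPt] : exists2 t, prime_set M t & ~ prime_set P t.
  apply: contrapT => nt; apply/neP/prime_set_inj/seteqP; split=> // t Mt.
  by apply: contrapT => nPt; apply: nt; exists t.
have [MD _ _ _ _] := prime_set_ideal M.
move=> x; have [xV|/notin_valring] := pselect (x \inr V); last first.
  rewrite mV => mx; right; apply: (localization_anti PM).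
  by have [+ _ _ _ _] := local_ideal_ideal M; apply.
left; rewrite -(mulKf (prime_set_neq0 nPt) x); apply: inrM.
  rewrite -[_^-1]mul1r; apply: localization_frac => //; first exact: inr1.
  exact: MD.
exact/(localization_anti PM)/mul_associated.
Qed.

(** As [x * M] is in [D_M], no prime strictly inside [M] contains the ideal
    [(D : x)]. If [M] were a limit of other points of [Y] above [(D : x)], then a
    set of such points with smallest closure having [M] as a limit would have a
    prime intersection between [(D : x)] and [M], that is [M] itself; but [M] is
    contained in no other prime. *)
Lemma isolated (Y : set (Spec D)) x : noetherian_on Y -> x \inr V ->
  exists d : D, ~ prime_set M (val d) /\
    forall P, Y P -> ~ prime_set P (val d) -> P <> M -> x \inr localization P.
Proof.
move=> noeY xV; apply: contrapT => niso.
pose S : set (Spec D) :=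
  [set P | [/\ Y P, P <> M & ~ x \inr localization P]].
pose cap (T : set (Spec D)) : set K :=
  [set d | d \inr D /\ forall P, T P -> prime_set P d].
have capS : cap S `<=` prime_set M.
  move=> _ [/inr_sub[d <-] Sd]; apply: contrapT => nMd; apply: niso.
  exists d; split=> // P YP nPd neP; apply: contrapT => nx.
  by apply: nPd; apply: Sd.
pose off (T : set (Spec D)) : set (Spec D) :=
  [set P : Spec D | exists d, cap T d /\ ~ prime_set P d].
pose F : set (set (Spec D)) := [set O | exists T, [/\ T `<=` S,
  cap T `<=` prime_set M & O = off T]].
have [||_ [T [TS TM ->]] maxT] := noetherian_maximal noeY (F := F).
- by exists (off S), S; split.
- move=> _ [T [_ _ ->]].
  have -> : off T = \bigcup_(d in [set d : D | cap T (val d)])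
      [set P : Spec D | ~ prime_set P (val d)].
    apply/seteqP; split=> P [d]; last by move=> Td nPd; exists (val d); split.
    move=> [[/inr_sub[e <-] Td] nPd].
    by exists e => //; split=> //; exact: inr_val.
  by apply: bigcup_open => d _; exact: open_nonzero.
have [MD M0 MA MM M1] := prime_set_ideal M.
have [P0 TP0] : T !=set0.
  apply: contrapT => T0; apply/M1/TM; split=> [|P TP]; first exact: inr1.
  by case: T0; exists P.
have capI : proper_ideal_in D (cap T).
  split.
  - by move=> d [].
  - split=> [|P _]; first exact: inr0.
    by have [_ + _ _ _] := prime_set_ideal P.
  - move=> d e [dD Td] [eD Te]; split=> [|P TP]; first exact: inrD.
    by have [_ _ + _ _] := prime_set_ideal P; apply; [exact: Td|exact: Te].
  - move=> b d bD [dD Td]; split=> [|P TP]; first exact: inrM.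
    by have [_ _ _ + _] := prime_set_ideal P; apply => //; exact: Td.
  - by move=> [_ /(_ _ TP0)]; have [_ _ _ _] := prime_set_ideal P0.
pose T_ a := T `&` [set P : Spec D | prime_set P a].
(* By minimality, the members of [T] containing [a] have [M] as a limit only if
   they are as dense as [T], hence only if [a] is in all members of [T]. *)
have shrink a : a \inr D -> cap (T_ a) `<=` prime_set M -> cap T a.
  move=> aD TaM; split=> // P TP; apply: contrapT => nPa.
  have [YP _ _] := TS _ TP.
  have [|||d [[_ Td] nPd]] := maxT (off (T_ a)) _ _ P.
  - by exists (T_ a); split=> // Q [/TS].
  - move=> Q [d [[dD Td] nQd]]; exists d; split=> //.
    by split=> // Q' [/Td].
  - by split=> //; exists a; split=> //; split=> // Q [].
  - exact/nPd/Td.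
have [a b aD bD [abD Tab]|Q QE] := prime_set_exists capI.
  apply: contrapT => /not_orP[/(contra_not (shrink a aD)) nTa].
  move=> /(contra_not (shrink b bD)) nTb.
  have [/existsNP[d /not_implyP[[dD Td] nMd]]] := conj nTa nTb.
  move=> /existsNP[e /not_implyP[[eD Te] nMe]].
  have [|//|//] := @prime_setM _ _ M d e dD eD _.
  apply: TM; split=> [|P TP]; first exact: inrM.
  have [_ _ _ PM _] := prime_set_ideal P.
  have [Pa|Pb] := prime_setM aD bD (Tab P TP).
    by rewrite mulrC; apply: PM => //; apply: Td.
  by apply: PM => //; apply: Te.
have MQ : prime_set M `<=` prime_set Q.
  move=> t Mt.
  have /localizationP[a [s [aD sD nMs txE]]] := mul_associated Mt xV.
  have tD := MD _ Mt; have s0 := prime_set_neq0 nMs.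
  have stx : s * t * x = a by rewrite -mulrA txE mulrC divfK.
  have : prime_set Q (s * t).
    rewrite QE; split=> [|P TP]; first exact: inrM.
    apply: contrapT => nPst; have [_ _] := TS _ TP; apply.
    rewrite -(mulKf (prime_set_neq0 nPst) x) stx mulrC.
    by apply: localization_frac => //; exact: inrM.
  by case/prime_setM => // Qs; case: nMs; apply: TM; rewrite -QE.
have [_ + _] := TS _ TP0; apply; apply: Max_eq maxM _ => t /MQ.
by rewrite QE => -[_ /(_ _ TP0)].
Qed.

End Associated.

Lemma sub_local_vmax P V W : valring V -> vmax V `<=` local_ideal P ->
  zar_set (subring_set D) W -> centered W P ->
  subring_set W `<=` subring_set V.
Proof.
move=> vV mV SW WP; have /zar_setP[_ vW] := SW.
by apply: vmax_antiI => // x /mV; exact: local_ideal_centered.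
Qed.

(** Below a maximal [M], a nonmaximal prime has a valuation ring as
    localization, whose fiber is a single point; the hypothesis deals with
    maximal ones. *)
Lemma noetherian_globalize (Y : set (Spec D)) :
  noetherian_on Y ->
  (forall M, Max D M -> exists V, [/\ zar_set (subring_set D) V,
    vmax V = local_ideal M &
    noetherian_on (fiber M)]) ->
  noetherian_on [set W : subring K | zar_set (subring_set D) W /\
    exists2 P, Y P & centered W P].
Proof.
move=> noeY assoc.
have /choice[F FP] : forall P, exists V,
    [/\ zar_set (subring_set D) V, vmax V = local_ideal P,
    noetherian_on (fiber P) &
    Max D P \/ V = localization P].
  move=> P; have [maxP|nmaxP] := pselect (Max D P).
    by have [V [SV mV noeP]] := assoc P maxP; exists V; split=> //; left.
  have [M maxM PM] := sub_Max P; have [V [SV mV _]] := assoc M maxM.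
  have neP : P <> M by move=> PM'; apply: nmaxP; rewrite PM'.
  have vP := localization_valring mV PM neP.
  have mP : vmax (localization P) = local_ideal P.
    have [IR I0 IA IM I1] := local_ideal_ideal P.
    apply/seteqP; split=> x mx.
      apply: contrapT => nx.
      have [x0 xi] := local_ideal_unit (vmax_inr vP mx) nx.
      exact: vmax_unit mx.
    have [->|x0] := eqVneq x 0; [by left|right=> xi].
    by apply: I1; rewrite -(mulVf x0); exact: IM.
  have SP : zar_set (subring_set D) (localization P).
    by apply/zar_setP; split=> //; exact: sub_localization.
  exists (localization P); split=> //; last by right.
  apply: noetherian_onS (noetherian_on1 (localization P)) => W [SW WP] /=.
  apply/subring_ext/seteqP; split; last exact: localization_sub_centered.
  by apply: sub_local_vmax SW WP => //; rewrite mP.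
apply: (noetherian_of_centers noeY (F := F)) => P YP.
have [SF mF noeP FE] := FP P; split=> //.
- by apply: localization_sub_centered => //; exact: associated_centered.
- move=> W; apply: sub_local_vmax; last by rewrite mF.
  by have /zar_setP[] := SF.
- case: FE => [maxP x xF|-> x].
    by have [d [nPd dP]] := isolated maxP mF noeY xF; exists d; split.
  move=> /localizationP[_ [_ [/inr_sub[a <-] /inr_sub[s <-] nPs ->]]].
  exists s; split=> // P' _ nP's _.
  by apply: localization_frac => //; exact: inr_val.
Qed.

End Centre.

(** * Noetherian Zariski spaces of integrally closed domains *)

Section Residue.
Variables (L : fieldType) (D : subring L).
Implicit Types (M : Max D) (V W : subring L).

Lemma quotient_fieldS (A B : subring L) : subring_set A `<=` subring_set B ->
  quotient_field A `<=` quotient_field B.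
Proof.
move=> AB x /quotient_fieldP[a [b [aA bA b0 ->]]].
by apply/quotient_fieldP; exists a, b; split=> //; exact: AB.
Qed.

Lemma zar_set_localization (P : Spec D) V :
  zar_set (subring_set (localization P)) V -> zar_set (subring_set D) V.
Proof.
move=> /zar_setP[RV vV]; apply/zar_setP; split=> // x xD.
exact/RV/sub_localization.
Qed.

(** The valuation rings of the residue field of [V = (m : m)] pull back to [V]
    and to minimal valuation rings above [D]. *)
Lemma pvd_residue_of_noetherian M : integrally_closed_in D ->
  noetherian_on (zar_min_set (subring_set D)) -> quotient_field D = setT ->
  pvd_noetherian_residue (localization (val M)).
Proof.
move=> Dint noeD qD; split; first exact: localization_pvd.
set P := val M; set R := localization P.
have maxP : Max D P := max_maximal M.
pose V := colon P; have vV : valring V := colon_valring Dint noeD P.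
have mV : vmax V = local_ideal P := vmax_colon Dint noeD P.
have RV : subring_set R `<=` subring_set V := @colon_sub _ _ P.
have SRV : zar_set (subring_set R) V by exact/zar_setP.
have SV := zar_set_localization SRV.
have [|N0 maxN0 N0m] := local_ring_Max (vmax_ideal vV).
  by move=> x _ /notin_vmax[].
have [|M0 maxM0 M0m] := local_ring_Max (local_ideal_ideal P).
  by move=> x xR /(local_ideal_unit xR)[].
pose N : Max V := exist _ N0 (mem_set maxN0).
exists V, N; split.
  split; last first.
    exists (exist _ M0 (mem_set maxM0)).
    by transitivity (local_ideal P); [exact: M0m|rewrite -mV -N0m].
  split=> // x _; have : quotient_field D x by rewrite qD.
  exact/quotient_fieldS/sub_localization.
apply/noetherian_ZarE.
apply: (noetherian_transfer (r := fun W B => W = @residue_pull _ V N B)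
   (B := zar_min_set (subring_set D) `|` [set V])).
- move=> B SB; exists (residue_pull B) => //.
  have SW := zar_residue_pull vV RV SB.
  have [|||->|] := @below_minimal _ D P V (residue_pull B) noeD maxP SV.
  - exact: associated_centered.
  - exact: zar_set_localization SW.
  - exact: residue_pull_sub.
  - by right.
  - by left.
- move=> O /open_residue_push[O' oO' O'P]; exists O' => // _ B _ ->.
  exact: O'P.
- by apply: noetherian_onU => //; exact: noetherian_on1.
Qed.

(** The fiber over [M] consists of the valuation rings between [m_V] and [V],
    which correspond to those of the residue field of [V]. *)
Lemma noetherian_fiber_of_residue M : quotient_field D = setT ->
  pvd_noetherian_residue (localization (val M)) ->
  exists V, [/\ zar_set (subring_set D) V, vmax V = local_ideal (val M) &
    noetherian_on (fiber (val M))].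
Proof.
move=> qD [_ [V [N [[[RV _ vdV] [M' M'N]] noeN]]]].
set P := val M in RV M' M'N noeN *; set R := localization P in RV M' M'N noeN.
have DV : subring_set D `<=` subring_set V by move=> x /sub_localization /RV.
have qV : quotient_field V = setT.
  by apply/seteqP; split=> // x _; apply: (quotient_fieldS DV); rewrite qD.
have SV : zar_set (subring_set D) V by split.
have /zar_setP[_ vV] := SV.
have mV : vmax V = local_ideal P.
  rewrite -(prime_set_valring N vV); transitivity (prime_set (val M')).
    exact/esym/M'N.
  apply: (local_ring_MaxE (local_ideal_ideal P)); last exact: max_maximal.
  by move=> x xR /(local_ideal_unit xR)[].
exists V; split=> //; move/noetherian_ZarE: noeN.
apply: (noetherian_transfer (r := fun B W => @residue_pull _ V N B = W)).
- move=> W [SW WP]; have WV : subring_set W `<=` subring_set V.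
    by apply: sub_local_vmax SW WP => //; rewrite mV.
  have [_ vW] := (zar_setP _ _).1 SW.
  exists (residue_push N W).
    apply: zar_residue_push => //; apply/zar_setP; split=> //.
    exact: localization_sub_centered.
  apply: residue_pushK => // x; rewrite mV => Px.
  exact/vmax_inr/(local_ideal_centered SW WP).
- move=> O /(@open_residue_pull _ V N) oO.
  by exists [set B | O (residue_pull B)] => // B W _ <-.
Qed.

End Residue.

Theorem corollary5p12 (L : fieldType) (D : subring L)
    (D_not_field : ~ is_field_ring D)
    (D_int_closed : integrally_closed_in D) :
  (noetherian_space (Zar (subring_set D)) <->
     [/\ quotient_field D = setT,
         noetherian_space (Spec D)
       & forall M : Max D, pvd_noetherian_residue (localization (val M))])
  /\
  (noetherian_space (set_type (Zar_min (subring_set D))) <->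
     [/\ quotient_field D = setT,
         noetherian_space (set_type (Max D))
       & forall M : Max D, pvd_noetherian_residue (localization (val M))]).
Proof.
have necessary : noetherian_on (zar_min_set (subring_set D)) ->
    quotient_field D = setT /\
    forall M : Max D, pvd_noetherian_residue (localization (val M)).
  move=> noeD.
  have qD := quotient_field_noetherian D_int_closed noeD D_not_field.
  by split=> // M; exact: pvd_residue_of_noetherian.
have sufficient (Y : set (Spec D)) : quotient_field D = setT ->
    noetherian_on Y ->
    (forall M : Max D, pvd_noetherian_residue (localization (val M))) ->
    noetherian_on [set W | zar_set (subring_set D) W /\
      exists2 P, Y P & centered W P].
  move=> qD noeY resD; apply: noetherian_globalize => // M maxM.
  exact: (noetherian_fiber_of_residue qD (resD (exist _ M (mem_set maxM)))).
split; split.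
- move=> /noetherian_ZarE noeZ.
  have [|qD resD] := necessary; first by apply: noetherian_onS noeZ => W [].
  split=> //; apply/noetherian_spaceE; apply: noetherian_centers noeZ => P _.
  exact: centered_exists.
- move=> [qD /noetherian_spaceE noeS resD]; apply/noetherian_ZarE.
  apply: noetherian_onS (sufficient _ qD noeS resD) => W SW.
  by split=> //; have [P WP] := center_exists SW; exists P.
- move=> /noetherian_Zar_minE noeZ; have [qD resD] := necessary noeZ.
  split=> //; apply/noetherian_set_type.
  by apply: noetherian_centers noeZ => P maxP; exact: Max_centered_min.
- move=> [qD /noetherian_set_type noeM resD]; apply/noetherian_Zar_minE.
  apply: noetherian_onS (sufficient _ qD noeM resD) => W minW.
  split; first by case: minW.
  have [P WP] := center_exists minW.1; exists P => //.
  exact: center_minimal minW WP.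
Qed.
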